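(* Let $m,r,s\ge 1$ be integers. Let $A\in (C^{(s-1)})^{m\times m}$ and $A_k\in (C^{(s-1)})^{m\times m}$ for $k\in\mathbb{N}$, and let $B\colon (C^{(s)})^{m}\to\mathbb{C}^{r}$ and $B_k\colon (C^{(s)})^{m}\to\mathbb{C}^{r}$, $k\in\mathbb{N}$, be continuous linear operators. For $y\in (C^{(s)})^m$ put $Ly:=y'+Ay$ and $L_ky:=y'+A_ky$, and consider the continuous linear operators $$(L,B),\ (L_k,B_k)\colon (C^{(s)})^m\to (C^{(s-1)})^m\times\mathbb{C}^r,\qquad y\mapsto (Ly,By),\quad y\mapsto(L_ky,B_ky).$$ If, as $k\to\infty$, the operators $(L_k,B_k)$ converge to $(L,B)$ in the strong operator topology, then the characteristic matrices $M(L_k,B_k)$ converge to $M(L,B)$ in the norm of the (finite-dimensional) space of complex matrices.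
   Context: Fix a finite interval $[a,b]$, $a<b$. $C^{(0)}$ is the complex Banach space of continuous functions $x\colon[a,b]\to\mathbb{C}$ with norm $\|x\|_{(0)}=\max_{[a,b]}|x(t)|$; for $l\in\mathbb{N}$, $l\ge1$, $C^{(l)}$ is the complex Banach space of $l$ times continuously differentiable functions $x\colon[a,b]\to\mathbb{C}$ with norm $\|x\|_{(l)}=\sum_{j=0}^{l}\|x^{(j)}\|_{(0)}$. $(C^{(l)})^m$ denotes the space of (column) vector-valued functions with $m$ components in $C^{(l)}$, with norm the sum of the norms of the components; $(C^{(l)})^{m\times m}$ denotes the space of $m\times m$ matrix-valued functions with entries in $C^{(l)}$, with norm the maximum of the norms of its columns in $(C^{(l)})^m$. The space $(C^{(s-1)})^m\times\mathbb{C}^r$ carries any standard product norm. Convergence in the strong operator topology means $(L_ky,B_ky)\to(Ly,By)$ in $(C^{(s-1)})^m\times\mathbb{C}^r$ for every $y\in(C^{(s)})^m$. Characteristic matrix: let $Y\in (C^{(s)})^{m\times m}$ be the unique solution of the matrix Cauchy problem $Y'(t)+A(t)Y(t)=0$ on $(a,b)$, $Y(a)=I_m$. The characteristic matrix $M(L,B)$ is the complex matrix with $r$ rows and $m$ columns whose $j$-th column is $B$ applied to the $j$-th column of $Y$, $j=1,\dots,m$. The matrix $M(L_k,B_k)$ is defined in the same way with $A_k$, $B_k$ in place of $A$, $B$. *)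

(* Defs.v *)
From HB Require Import structures.
From mathcomp Require Import all_boot all_order all_algebra.
From mathcomp Require Import complex.
From mathcomp Require Import all_classical all_reals all_analysis.
From mathcomp Require Import ring lra.

Set Implicit Arguments.
Unset Strict Implicit.
Unset Printing Implicit Defensive.

Import Order.TTheory GRing.Theory Num.Theory.
Import numFieldNormedType.Exports.
Local Open Scope classical_set_scope.
Local Open Scope ring_scope.
Local Open Scope complex_scope.

(* Gives R[i] its modulus topology as a normed space over itself. *)
HB.instance Definition _ (R : rcfType) := NormedModule.copy R[i] R[i]^o.

(* A function [a, b] -> C is represented by its extension by 0 to the whole   *)
(* real line, so that equality of representatives is equality on [a, b].      *)
(* Limits are taken within [a, b]: the notions are one-sided at a and at b.   *)
Section interval_functions.
Context {R : realType} (a b : R).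
Implicit Types (x y : R -> R[i]) (t : R).

Definition dquot x t : R -> R[i] := fun u => (x u - x t) / (u - t)%:C.

Definition derivable_itv x t : Prop :=
  cvg (dquot x t @ within `[a, b] t^').

Definition deriv_itv x : R -> R[i] := fun t =>
  if t \in `[a, b] then lim (dquot x t @ within `[a, b] t^') else 0.

Definition derivn_itv k x : R -> R[i] := iter k deriv_itv x.

Definition is_Cl (l : nat) x : Prop :=
  [/\ forall t, t \notin `[a, b] -> x t = 0,
      forall k t, (k < l)%N -> t \in `[a, b] -> derivable_itv (derivn_itv k x) t
    & forall k, (k <= l)%N -> {within `[a, b], continuous (derivn_itv k x)}].

Definition sup_norm x : R := sup [set Normc.normc (x t) | t in `[a, b]].

Definition Cl_norm (l : nat) x : R :=
  \sum_(k < l.+1) sup_norm (derivn_itv k x).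

End interval_functions.

Section theory.
Context {R : realType} (a b : R).
Implicit Types (x y : R -> R[i]) (t : R) (l : nat).
Hypothesis hab : a < b.

Lemma within_itv_dnbhs_proper t :
  t \in `[a, b] -> ProperFilter (within `[a, b] t^').
Proof.
move=> tab; apply: Build_ProperFilter_ex => P.
rewrite /within /= => /nbhs_ballP[e /= e0 eP].
move: tab; rewrite in_itv /= => /andP[at_ tb].
have [ltb|] := ltP t b.
  pose d := Num.min (e / 2) (b - t).
  have d0 : 0 < d by rewrite lt_min divr_gt0//= subr_gt0.
  exists (t + d); apply: eP.
  - rewrite /ball /= opprD addrA subrr sub0r normrN gtr0_norm//.
    by rewrite gt_min ltr_pdivrMr// mulr2n mulrDr mulr1 ltrDl e0.
  - by rewrite /= -subr_eq0 addrAC subrr add0r gt_eqF.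
  - have db : d <= b - t by rewrite /d ge_min lexx orbT.
    by rewrite /= in_itv /=; apply/andP; split; lra.
move=> bt; have {tb bt}tb : t = b by apply/eqP; rewrite eq_le tb.
pose d := Num.min (e / 2) (b - a).
have d0 : 0 < d by rewrite lt_min divr_gt0//= subr_gt0.
exists (t - d); apply: eP.
- rewrite /ball /= opprB addrC subrK gtr0_norm//.
  by rewrite gt_min ltr_pdivrMr// mulr2n mulrDr mulr1 ltrDl e0.
- by rewrite /= -subr_eq0 addrAC subrr add0r oppr_eq0 gt_eqF.
- have db : d <= b - a by rewrite /d ge_min lexx orbT.
  by rewrite /= in_itv /= tb; apply/andP; split; lra.
Qed.

Lemma deriv_itv_out x t : t \notin `[a, b] -> deriv_itv a b x t = 0.
Proof. by rewrite /deriv_itv => /negbTE ->. Qed.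

Lemma deriv_itvP x t (d : R[i]) : t \in `[a, b] ->
  dquot x t @ within `[a, b] t^' --> d ->
  derivable_itv a b x t /\ deriv_itv a b x t = d.
Proof.
move=> tab xd; have PF := within_itv_dnbhs_proper tab.
split; first by apply/cvg_ex; exists d.
by rewrite /deriv_itv tab; apply: cvg_lim.
Qed.

Lemma derivable_itvP x t : t \in `[a, b] -> derivable_itv a b x t ->
  dquot x t @ within `[a, b] t^' --> deriv_itv a b x t.
Proof. by move=> tab; rewrite /deriv_itv tab => /cvg_ex[d xd]; apply/cvg_ex; exists d. Qed.

#[local] Opaque deriv_itv derivable_itv sup_norm.

Lemma deriv_itvD x y t : t \in `[a, b] ->
  derivable_itv a b x t -> derivable_itv a b y t ->
  derivable_itv a b (x \+ y) t /\
  deriv_itv a b (x \+ y) t = deriv_itv a b x t + deriv_itv a b y t.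
Proof.
move=> tab /(derivable_itvP tab) xd /(derivable_itvP tab) yd.
apply: (deriv_itvP tab).
rewrite (_ : dquot _ t = dquot x t \+ dquot y t).
  have PF := within_itv_dnbhs_proper tab.
  by apply: cvgD; [exact xd|exact yd].
by apply/funext => u; rewrite /dquot /= -mulrDl opprD addrACA.
Qed.

Lemma deriv_itvZ (c : R[i]) x t : t \in `[a, b] ->
  derivable_itv a b x t ->
  derivable_itv a b (c \*o x) t /\
  deriv_itv a b (c \*o x) t = c * deriv_itv a b x t.
Proof.
move=> tab /(derivable_itvP tab) xd.
apply: (deriv_itvP tab).
rewrite (_ : dquot _ t = fun u => c * dquot x t u).
  have PF := within_itv_dnbhs_proper tab.
  by apply: cvgMr; exact xd.
by apply/funext => u; rewrite /dquot /= mulrA mulrBr.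
Qed.

Lemma cvg_within_dnbhs x t : {within `[a, b], continuous x} ->
  t \in `[a, b] -> x @ within `[a, b] t^' --> x t.
Proof.
move=> /subspace_continuousP /(_ t) xc tab.
apply: cvg_trans (xc tab) => P; rewrite /= /nbhs /= /within /= => tP.
exact: cvg_within tP.
Qed.

Lemma deriv_itvM x y t : t \in `[a, b] ->
  {within `[a, b], continuous x} ->
  derivable_itv a b x t -> derivable_itv a b y t ->
  derivable_itv a b (x \* y) t /\
  deriv_itv a b (x \* y) t = deriv_itv a b x t * y t + x t * deriv_itv a b y t.
Proof.
move=> tab xc /(derivable_itvP tab) xd /(derivable_itvP tab) yd.
apply: (deriv_itvP tab).
rewrite (_ : dquot _ t = fun u => dquot x t u * y t + x u * dquot y t u).
  have PF := within_itv_dnbhs_proper tab.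
  apply: cvgD; first by apply: cvgMl; exact xd.
  by apply: cvgM; [exact (cvg_within_dnbhs xc tab)|exact yd].
by apply/funext => u; rewrite /dquot /=; ring.
Qed.

Lemma is_ClS l x : is_Cl a b l.+1 x <->
  [/\ forall t, t \notin `[a, b] -> x t = 0,
      {within `[a, b], continuous x},
      forall t, t \in `[a, b] -> derivable_itv a b x t
    & is_Cl a b l (deriv_itv a b x)].
Proof.
have E k : derivn_itv a b k (deriv_itv a b x) = derivn_itv a b k.+1 x.
  by rewrite /derivn_itv -iterSr.
split=> [[x0 xd xc]|[x0 xc xd [_ xd' xc']]].
  split=> //; [exact: (xc 0%N)|by move=> t; exact: (xd 0%N)|split].
  - exact: deriv_itv_out.
  - by move=> k t kl; rewrite E; exact: xd.
  - by move=> k kl; rewrite E; exact: xc.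
split=> // [[|k] t kl tab|[|k] kl]; [exact: xd| |exact: xc|].
- by rewrite -E; exact: xd'.
- by rewrite -E; exact: xc'.
Qed.

Lemma is_Cl_le l l' x : (l <= l')%N -> is_Cl a b l' x -> is_Cl a b l x.
Proof.
move=> ll' [x0 xd xc]; split=> // [k t kl|k kl].
  by apply: xd; exact: leq_trans ll'.
by apply: xc; exact: leq_trans ll'.
Qed.

Lemma is_Cl_0 l : is_Cl a b l (fun=> 0).
Proof.
elim: l => [|l IH].
  split=> // -[|//] _; apply: continuous_subspaceT => t; exact: cvg_cst.
have d0 t : t \in `[a, b] ->
    derivable_itv a b (fun=> 0) t /\ deriv_itv a b (fun=> 0) t = 0.
  move=> tab; apply: (deriv_itvP tab).
  rewrite (_ : dquot _ t = fun=> 0); first exact: cvg_cst.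
  by apply/funext => u; rewrite /dquot subrr mul0r.
have E : deriv_itv a b (fun=> 0) = fun=> 0.
  apply/funext => t; have [tab|tab] := boolP (t \in `[a, b]).
    exact (d0 t tab).2.
  exact: deriv_itv_out.
apply/is_ClS; split.
- by move=> t _.
- by apply: continuous_subspaceT => t; exact: cvg_cst.
- by move=> t tab; exact (d0 t tab).1.
- by rewrite E; exact IH.
Qed.

Lemma is_Cl0P x : is_Cl a b 0 x <->
  (forall t, t \notin `[a, b] -> x t = 0) /\ {within `[a, b], continuous x}.
Proof.
split=> [[x0 _ xc]|[x0 xc]]; first by split; [exact x0|exact (xc 0%N isT)].
split; [exact x0|by move=> k t kl; exfalso; rewrite ltn0 in kl|].
case=> [_|k kl]; [exact xc|by exfalso; rewrite ltn0 in kl].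
Qed.

Lemma within_continuousZ (c : R[i]) x : {within `[a, b], continuous x} ->
  {within `[a, b], continuous (c \*o x)}.
Proof. by move=> xc t; apply: cvgMr; exact (xc t). Qed.

Lemma within_continuousM x y : {within `[a, b], continuous x} ->
  {within `[a, b], continuous y} -> {within `[a, b], continuous (x \* y)}.
Proof. by move=> xc yc t; apply: cvgM; [exact (xc t)|exact (yc t)]. Qed.

Lemma is_ClD l x y : is_Cl a b l x -> is_Cl a b l y ->
  is_Cl a b l (x \+ y) /\
  forall k, (k <= l)%N ->
    derivn_itv a b k (x \+ y) = derivn_itv a b k x \+ derivn_itv a b k y.
Proof.
elim: l x y => [|l IH] x y Cx Cy.
  split; last by case=> [_|k kl]; [exact: erefl|exfalso; rewrite ltn0 in kl].
  move: Cx Cy => /is_Cl0P[x0 xc] /is_Cl0P[y0 yc]; apply/is_Cl0P; split.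
    by move=> t tab; rewrite /= (x0 _ tab) (y0 _ tab) addr0.
  exact (within_continuousD xc yc).
move: Cx Cy => /is_ClS[x0 xc xd Cx'] /is_ClS[y0 yc yd Cy'].
have E : deriv_itv a b (x \+ y) = deriv_itv a b x \+ deriv_itv a b y.
  apply/funext => t; have [tab|tab] := boolP (t \in `[a, b]).
    exact (deriv_itvD tab (xd _ tab) (yd _ tab)).2.
  by rewrite /= !(deriv_itv_out _ tab) addr0.
have [C' D'] := IH _ _ Cx' Cy'; split.
  apply/is_ClS; split.
  - by move=> t tab; rewrite /= (x0 _ tab) (y0 _ tab) addr0.
  - exact (within_continuousD xc yc).
  - by move=> t tab; exact (deriv_itvD tab (xd _ tab) (yd _ tab)).1.
  - by rewrite E; exact C'.
case=> [_|k kl]; first exact: erefl.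
by rewrite /derivn_itv !iterSr E; exact (D' k kl).
Qed.

Lemma is_ClZ l (c : R[i]) x : is_Cl a b l x ->
  is_Cl a b l (c \*o x) /\
  forall k, (k <= l)%N ->
    derivn_itv a b k (c \*o x) = c \*o derivn_itv a b k x.
Proof.
elim: l x => [|l IH] x Cx.
  split; last by case=> [_|k kl]; [exact: erefl|exfalso; rewrite ltn0 in kl].
  move: Cx => /is_Cl0P[x0 xc]; apply/is_Cl0P; split.
    by move=> t tab; rewrite /= (x0 _ tab) mulr0.
  exact (within_continuousZ (c := c) xc).
move: Cx => /is_ClS[x0 xc xd Cx'].
have E : deriv_itv a b (c \*o x) = c \*o deriv_itv a b x.
  apply/funext => t; have [tab|tab] := boolP (t \in `[a, b]).
    exact (deriv_itvZ c tab (xd _ tab)).2.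
  by rewrite /= !(deriv_itv_out _ tab) mulr0.
have [C' D'] := IH _ Cx'; split.
  apply/is_ClS; split.
  - by move=> t tab; rewrite /= (x0 _ tab) mulr0.
  - exact (within_continuousZ (c := c) xc).
  - by move=> t tab; exact (deriv_itvZ c tab (xd _ tab)).1.
  - by rewrite E; exact C'.
case=> [_|k kl]; first exact: erefl.
by rewrite /derivn_itv !iterSr E; exact (D' k kl).
Qed.

Lemma is_ClM l x y : is_Cl a b l x -> is_Cl a b l y -> is_Cl a b l (x \* y).
Proof.
elim: l x y => [|l IH] x y Cx Cy.
  move: Cx Cy => /is_Cl0P[x0 xc] /is_Cl0P[y0 yc]; apply/is_Cl0P; split.
    by move=> t tab; rewrite /= (x0 _ tab) mul0r.
  exact (within_continuousM xc yc).
have [Cx1 Cy1] := (is_Cl_le (leqnSn l) Cx, is_Cl_le (leqnSn l) Cy).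
move: Cx Cy => /is_ClS[x0 xc xd Cx'] /is_ClS[y0 yc yd Cy'].
have E : deriv_itv a b (x \* y) =
    (deriv_itv a b x \* y) \+ (x \* deriv_itv a b y).
  apply/funext => t; have [tab|tab] := boolP (t \in `[a, b]).
    exact (deriv_itvM tab xc (xd _ tab) (yd _ tab)).2.
  by rewrite /= !(deriv_itv_out _ tab) mul0r mulr0 addr0.
apply/is_ClS; split.
- by move=> t tab; rewrite /= (x0 _ tab) mul0r.
- exact (within_continuousM xc yc).
- by move=> t tab; exact (deriv_itvM tab xc (xd _ tab) (yd _ tab)).1.
- by rewrite E; exact (is_ClD (IH _ _ Cx' Cy1) (IH _ _ Cx1 Cy')).1.
Qed.

Lemma is_Cl_sum l (I : Type) (r : seq I) (F : I -> R -> R[i]) :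
  (forall i, is_Cl a b l (F i)) -> is_Cl a b l (fun t => \sum_(i <- r) F i t).
Proof.
move=> CF; elim: r => [|i r IH].
  rewrite (_ : (fun _ => _) = fun=> 0); first exact: is_Cl_0.
  by apply/funext => t; rewrite big_nil.
rewrite (_ : (fun _ => _) = F i \+ (fun t => \sum_(i <- r) F i t)).
  exact: (is_ClD (CF i) IH).1.
by apply/funext => t; rewrite big_cons.
Qed.

Lemma normcE (z : R[i]) : (Normc.normc z)%:C = `|z|.
Proof. by case: z. Qed.

Lemma normc_ge0 (z : R[i]) : 0 <= Normc.normc z.
Proof. by rewrite -lecR normcE; exact: normr_ge0. Qed.

Lemma normcD (z w : R[i]) :
  Normc.normc (z + w) <= Normc.normc z + Normc.normc w.
Proof. by rewrite -lecR rmorphD /= !normcE ler_normD. Qed.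

Lemma normc_continuous : continuous (@Normc.normc R).
Proof.
move=> z; apply/(@cvgrPdist_lt _ _ _ (nbhs z) (nbhs_filter z)) => e e0.
apply/nbhs_ballP; exists e%:C; first by rewrite /= ltcR.
move=> w; rewrite /ball /= -normcE ltcR; apply: le_lt_trans.
have := normcD (z - w) w; have := normcD (w - z) z; rewrite !subrK.
have -> : Normc.normc (w - z) = Normc.normc (z - w).
  by apply: complexI; rewrite !normcE distrC.
by move=> h1 h2; rewrite ler_norml; apply/andP; split; lra.
Qed.

Lemma sup_norm_has_sup x : {within `[a, b], continuous x} ->
  has_sup [set Normc.normc (x t) | t in `[a, b]].
Proof.
move=> xc; have aab : a \in `[a, b] by rewrite in_itv /= lexx ltW.
split; first by exists (Normc.normc (x a)); exists a.
have nc : {within `[a, b], continuous (@Normc.normc R \o x)}.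
  by apply: within_continuous_comp => // z _; exact: normc_continuous.
have [c cab cmax] := EVT_max (ltW hab) nc.
exists (Normc.normc (x c)) => _ [t tab <-]; exact: cmax.
Qed.

Lemma normc_le_sup_norm x t : {within `[a, b], continuous x} ->
  t \in `[a, b] -> Normc.normc (x t) <= sup_norm a b x.
Proof.
move=> /sup_norm_has_sup[_ xu] tab; apply: ub_le_sup => //; by exists t.
Qed.

Lemma sup_norm_le x (M : R) :
  (forall t, t \in `[a, b] -> Normc.normc (x t) <= M) -> sup_norm a b x <= M.
Proof.
move=> xM; apply: ge_sup => [|_ [t tab <-]]; last exact: xM.
by exists (Normc.normc (x a)); exists a => //=; rewrite in_itv /= lexx ltW.
Qed.

Lemma sup_norm_ge0 x : {within `[a, b], continuous x} -> 0 <= sup_norm a b x.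
Proof.
move=> xc; apply: le_trans (normc_le_sup_norm (t := a) xc _).
  exact: normc_ge0.
by rewrite in_itv /= lexx ltW.
Qed.

Lemma sup_normD x y : {within `[a, b], continuous x} ->
  {within `[a, b], continuous y} ->
  sup_norm a b (x \+ y) <= sup_norm a b x + sup_norm a b y.
Proof.
move=> xc yc; apply: sup_norm_le => t tab.
apply: le_trans (lerD (normc_le_sup_norm xc tab) (normc_le_sup_norm yc tab)).
exact: normcD.
Qed.

Lemma sup_normZ (c : R[i]) x : {within `[a, b], continuous x} ->
  sup_norm a b (c \*o x) = Normc.normc c * sup_norm a b x.
Proof.
have le (z : R -> R[i]) (d : R[i]) : {within `[a, b], continuous z} ->
    sup_norm a b (d \*o z) <= Normc.normc d * sup_norm a b z.
  move=> zc; apply: sup_norm_le => t tab /=.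
  by rewrite Normc.normcM ler_wpM2l ?normc_ge0 ?(normc_le_sup_norm zc tab).
move=> xc; apply/eqP; rewrite eq_le (le _ _ xc) /=.
have [->|c0] := eqVneq c 0.
  by rewrite Normc.normc0 mul0r (sup_norm_ge0 (within_continuousZ (c := 0) xc)).
have nc0 : 0 < Normc.normc c.
  rewrite lt_neqAle normc_ge0 andbT eq_sym.
  by apply: contra c0 => /eqP/Normc.eq0_normc ->.
rewrite -ler_pdivlMl// -Normc.normcV.
have -> : sup_norm a b x = sup_norm a b (c^-1 \*o (c \*o x)).
  by congr sup_norm; apply/funext => t /=; rewrite mulKf.
exact (le _ _ (within_continuousZ (c := c) xc)).
Qed.

Lemma Cl_normD l x y : is_Cl a b l x -> is_Cl a b l y ->
  Cl_norm a b l (x \+ y) <= Cl_norm a b l x + Cl_norm a b l y.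
Proof.
move=> Cx Cy; have [_ _ xc] := Cx; have [_ _ yc] := Cy.
rewrite /Cl_norm -big_split /=; apply: ler_sum => k _.
have kl : (k <= l)%N by rewrite -ltnS ltn_ord.
by rewrite ((is_ClD Cx Cy).2 _ kl) (sup_normD (xc _ kl) (yc _ kl)).
Qed.

Lemma Cl_normZ l (c : R[i]) x : is_Cl a b l x ->
  Cl_norm a b l (c \*o x) = Normc.normc c * Cl_norm a b l x.
Proof.
move=> Cx; have [_ _ xc] := Cx; rewrite /Cl_norm mulr_sumr.
apply: eq_bigr => k _; have kl : (k <= l)%N by rewrite -ltnS ltn_ord.
by rewrite ((is_ClZ c Cx).2 _ kl) (sup_normZ c (xc _ kl)).
Qed.

Lemma Cl_norm_ge0 l x : is_Cl a b l x -> 0 <= Cl_norm a b l x.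
Proof.
move=> [_ _ xc]; apply: sumr_ge0 => k _; apply: sup_norm_ge0.
by apply: xc; rewrite -ltnS ltn_ord.
Qed.

Lemma normc_le_Cl_norm l x t : is_Cl a b l x -> t \in `[a, b] ->
  Normc.normc (x t) <= Cl_norm a b l x.
Proof.
move=> [_ _ xc] tab.
apply: (le_trans (normc_le_sup_norm (xc 0%N isT) tab)).
rewrite /Cl_norm big_ord_recl lerDl; apply: sumr_ge0 => k _.
by apply: sup_norm_ge0; apply: xc; rewrite -ltnS ltn_ord.
Qed.

End theory.

(* The space of l times continuously differentiable m x n matrix functions on *)
(* [a, b]; column vector functions are the case n = 1.                        *)
Definition Cmx_pred {R : realType} (a b : R) m n l :
    {pred (R -> 'M[R[i]]_(m, n))} :=
  fun f => `[< forall i j, is_Cl a b l (fun t => f t i j) >].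

Arguments Cmx_pred {R} a b m n l f.

(* The phantom parameter hab is what the normed space structure below needs.  *)
Record Cspace {R : realType} {a b : R} (hab : a < b) (m n l : nat) :=
  MkCspace {
    Cfun :> R -> 'M[R[i]]_(m, n);
    Cfun_subproof : Cfun \in Cmx_pred a b m n l }.

Section Cspace_normed.
Context {R : realType} {a b : R} (hab : a < b) (m n l : nat).
Local Notation Cspace := (Cspace hab m n l).
Local Notation Cmx_pred := (Cmx_pred a b m n l).

HB.instance Definition _ := [isSub for @Cfun R a b hab m n l].
HB.instance Definition _ := [Choice of Cspace by <:].

Lemma CspaceP (f : Cspace) i j : is_Cl a b l (fun t => f t i j).
Proof. by case: f => /= f /asboolP Cf; exact (Cf i j). Qed.

Lemma Cmx_submod_closed : submod_closed Cmx_pred.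
Proof.
split=> [|c f g /asboolP Cf /asboolP Cg]; apply/asboolP => i j.
  have -> : (fun t => (0 : R -> 'M[R[i]]_(m, n)) t i j) = fun=> 0.
    by apply/funext => t; rewrite mxE.
  exact (is_Cl_0 hab l).
have -> : (fun t => (c *: f + g) t i j) =
    (c \*o (fun t => f t i j)) \+ (fun t => g t i j).
  by apply/funext => t; rewrite !mxE.
exact (is_ClD hab (is_ClZ hab c (Cf i j)).1 (Cg i j)).1.
Qed.

HB.instance Definition _ := GRing.isSubmodClosed.Build _ _ _ Cmx_submod_closed.
HB.instance Definition _ := [SubChoice_isSubLmodule of Cspace by <:].

(* The maximum over the columns of the sum of the norms of the components. *)
Definition Cspace_norm (f : Cspace) : R :=
  \big[Num.max/0]_(j < n) \sum_(i < m) Cl_norm a b l (fun t => f t i j).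

Lemma CspaceDE (f g : Cspace) i j :
  (fun t => (f + g) t i j) = (fun t => f t i j) \+ (fun t => g t i j).
Proof. by apply/funext => t; rewrite mxE. Qed.

Lemma CspaceZE (c : R[i]) (f : Cspace) i j :
  (fun t => (c *: f) t i j) = c \*o (fun t => f t i j).
Proof. by apply/funext => t; rewrite mxE. Qed.

Lemma le_Cspace_norm (f : Cspace) i j :
  Cl_norm a b l (fun t => f t i j) <= Cspace_norm f.
Proof.
apply: (@le_trans _ _ (\sum_(i < m) Cl_norm a b l (fun t => f t i j))).
  rewrite (bigD1 i)//= lerDl; apply: sumr_ge0 => k _.
  exact (Cl_norm_ge0 hab (CspaceP f k j)).
exact: (le_bigmax _ (fun j => \sum_(i < m) Cl_norm a b l (fun t => f t i j))).
Qed.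

Lemma Cspace_normD (f g : Cspace) :
  Cspace_norm (f + g) <= Cspace_norm f + Cspace_norm g.
Proof.
apply/bigmax_leP; split=> [|j _].
  by apply: addr_ge0; exact: bigmax_ge_id.
apply: le_trans (lerD
  (le_bigmax _ (fun j => \sum_(i < m) Cl_norm a b l (fun t => f t i j)) j)
  (le_bigmax _ (fun j => \sum_(i < m) Cl_norm a b l (fun t => g t i j)) j)).
rewrite -big_split /=; apply: ler_sum => i _.
rewrite CspaceDE; exact (Cl_normD hab (CspaceP f i j) (CspaceP g i j)).
Qed.

Lemma Cspace_normZ (c : R[i]) (f : Cspace) :
  Cspace_norm (c *: f) = Normc.normc c * Cspace_norm f.
Proof.
rewrite /Cspace_norm; under eq_bigr => j _.
  under eq_bigr => i _ do rewrite CspaceZE (Cl_normZ hab _ (CspaceP f i j)).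
  rewrite -mulr_sumr; over.
elim/big_ind2 : _ => //; first by rewrite mulr0.
by move=> x1 x2 y1 y2 -> ->; rewrite maxr_pMr// normc_ge0.
Qed.

Lemma Cspace_norm_eq0 (f : Cspace) : (Cspace_norm f)%:C = 0 -> f = 0.
Proof.
move=> /complexI f0; apply/val_inj/funext => t; apply/matrixP => i j.
rewrite mxE; have [tab|tab] := boolP (t \in `[a, b]).
  apply: Normc.eq0_normc; apply/eqP; rewrite eq_le normc_ge0 andbT -f0.
  apply: le_trans (le_Cspace_norm f i j).
  exact (normc_le_Cl_norm hab (CspaceP f i j) tab).
by have [f_out _ _] := CspaceP f i j; exact (f_out t tab).
Qed.

Lemma Cspace_normDC (f g : Cspace) :
  (Cspace_norm (f + g))%:C <= (Cspace_norm f)%:C + (Cspace_norm g)%:C.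
Proof. by rewrite -rmorphD /= lecR Cspace_normD. Qed.

Lemma Cspace_normZC (c : R[i]) (f : Cspace) :
  (Cspace_norm (c *: f))%:C = `|c| * (Cspace_norm f)%:C.
Proof. by rewrite Cspace_normZ rmorphM /= normcE. Qed.

HB.instance Definition _ := Lmodule_isNormed.Build R[i] Cspace
  Cspace_normDC Cspace_normZC Cspace_norm_eq0.

End Cspace_normed.

Definition mderiv {R : realType} (a b : R) m n (f : R -> 'M[R[i]]_(m, n)) :
  R -> 'M[R[i]]_(m, n) :=
  fun t => \matrix_(i, j) deriv_itv a b (fun u => f u i j) t.

Section operators.
Context {R : realType} {a b : R} {hab : a < b} {m r s : nat}.

Lemma Ccol_subproof l n (Y : Cspace hab m n l) (j : 'I_n) :
  (fun t => col j (Y t)) \in Cmx_pred a b m 1 l.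
Proof.
apply/asboolP => i k.
have -> : (fun t => col j (Y t) i k) = fun t => Y t i j.
  by apply/funext => t; rewrite mxE.
exact (CspaceP Y i j).
Qed.

Definition Ccol l n (Y : Cspace hab m n l) (j : 'I_n) : Cspace hab m 1 l :=
  MkCspace hab (Ccol_subproof Y j).

Lemma Lop_subproof (hs : (0 < s)%N) (A : Cspace hab m m s.-1)
    (y : Cspace hab m 1 s) :
  (fun t => mderiv a b y t + A t *m y t) \in Cmx_pred a b m 1 s.-1.
Proof.
apply/asboolP => i j.
have -> : (fun t => (mderiv a b y t + A t *m y t) i j) =
    deriv_itv a b (fun u => y u i j) \+
    (fun t => \sum_(k < m) A t i k * y t k j).
  by apply/funext => t; rewrite !mxE.
have Cy : is_Cl a b s.-1.+1 (fun u => y u i j).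
  by rewrite prednK//; exact (CspaceP y i j).
move: Cy => /is_ClS[_ _ _ Cy'].
apply: (is_ClD hab Cy' _).1; apply: (is_Cl_sum hab) => k.
exact (is_ClM hab (CspaceP A i k) (is_Cl_le (leq_pred s) (CspaceP y k j))).
Qed.

Definition Lop (hs : (0 < s)%N) (A : Cspace hab m m s.-1)
    (y : Cspace hab m 1 s) : Cspace hab m 1 s.-1 :=
  MkCspace hab (Lop_subproof hs A y).

Definition LBop (hs : (0 < s)%N) (A : Cspace hab m m s.-1)
    (B : Cspace hab m 1 s -> 'cV[R[i]]_r) (y : Cspace hab m 1 s) :
  (Cspace hab m 1 s.-1 * 'cV[R[i]]_r)%type := (Lop hs A y, B y).

Definition cauchy_problem (A : Cspace hab m m s.-1) : set (Cspace hab m m s) :=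
  [set Y | (forall t, t \in `]a, b[ -> mderiv a b Y t + A t *m Y t = 0) /\
           Y a = 1%:M].

(* For 0 < s the problem has a unique solution, so that xget never returns    *)
(* its default value.                                                         *)
Definition cauchy_sol (A : Cspace hab m m s.-1) : Cspace hab m m s :=
  xget 0 (cauchy_problem A).

Definition char_mx (A : Cspace hab m m s.-1)
    (B : Cspace hab m 1 s -> 'cV[R[i]]_r) : 'M[R[i]]_(r, m) :=
  \matrix_(i < r, j < m) B (Ccol (cauchy_sol A) j) i 0.

End operators.

(* Main.v *)
Require Import Defs.
From mathcomp Require Import all_boot all_order all_algebra.
From mathcomp Require Import complex.
From mathcomp Require Import all_classical all_reals all_analysis.
From mathcomp Require Import ring lra.

(** Write [Y_k] and [Y] for the solutions of the Cauchy problems of [A_k] and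
    [A], and [n] for [s - 1]. Column by column,
      [B_k Y_k - B Y = B_k (Y_k - Y) + (B_k Y - B Y)],
    where the last term tends to 0 by strong convergence at the column of [Y].
    The first one tends to 0 because the [B_k] are uniformly bounded and
    [Y_k - Y] tends to 0 in [C^(n+1)].

    The [B_k] are pointwise bounded since they converge strongly, hence
    uniformly bounded by the Banach-Steinhaus theorem ([uniform_boundedness]),
    which rests on the completeness of the spaces of C^l functions
    ([Cl_complete], [Cspace_complete]).

    For a column [y] of [Y] and the same column [y_k] of [Y_k], the difference
    [z = y_k - y] vanishes at [a] and satisfies
    [L_k z = - L_k y = - (L_k y - L y)], which tends to 0 in [C^n] by strong
    convergence, applied directly to the limit solution. Constant unit vectors
    are mapped by [L_k] to the columns of [A_k], so that the [A_k] are bounded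
    in [C^n]. The a priori estimate [Cl_norm_a_priori] bounds [z] in [C^(n+1)]
    by [L_k z] in [C^n], with a constant depending only on a bound of [A_k];
    whence the convergence ([cauchy_sol_cvg]).

    Both the a priori estimate and the existence of solutions
    ([linear_system_solution], by Picard iteration) rest on [weight_halving]:
    with respect to the weight [exp (2 K (t - a))], where [K] dominates the
    coefficients, integrating the equation once divides a bound by 2. The
    passage from derivatives to functions is the mean value inequality
    [normc_sub_le_of_deriv]; primitives come from the fundamental theorem of
    calculus. *)

Set Implicit Arguments.
Unset Strict Implicit.
Unset Printing Implicit Defensive.

Import Order.TTheory GRing.Theory Num.Theory.
Import numFieldNormedType.Exports.
Local Open Scope classical_set_scope.
Local Open Scope ring_scope.
Local Open Scope complex_scope.

Local Notation normc := Normc.normc.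

(** * Complex modulus and epsilon criteria *)

Section modulus.
Context {R : realType}.
Implicit Types (z w : R[i]) (p q : R).

Lemma normcR p : normc p%:C = `|p|.
Proof. by rewrite /= expr0n addr0 sqrtr_sqr. Qed.

Lemma normcN z : normc (- z) = normc z.
Proof. by case: z => p q /=; rewrite !sqrrN. Qed.

Lemma normcB z w : normc (z - w) = normc (w - z).
Proof. by rewrite -normcN opprB. Qed.

Lemma normc_le_sub z w : normc z <= normc w + normc (z - w).
Proof. by have := normcD w (z - w); rewrite addrC subrK addrC. Qed.

Lemma normc_sum I (r : seq I) (F : I -> R[i]) :
  normc (\sum_(i <- r) F i) <= \sum_(i <- r) normc (F i).
Proof.
elim/big_ind2 : _ => //; first by rewrite Normc.normc0.
by move=> x1 x2 y1 y2 h1 h2; apply: le_trans (normcD _ _) (lerD h1 h2).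
Qed.

Lemma Re_le_normc z : `|complex.Re z| <= normc z.
Proof. by have := normc_ge_Re z; rewrite -Defs.normcE lecR. Qed.

Lemma Im_le_normc z : `|complex.Im z| <= normc z.
Proof.
by have := Re_le_normc (z * 'i); rewrite ReiNIm normrN Normc.normcM /= expr0n
  add0r expr1n sqrtr1 mulr1.
Qed.

Lemma normc_le_ReIm p q : normc (p +i* q) <= `|p| + `|q|.
Proof.
have -> : p +i* q = p%:C + 0 +i* q.
  by apply/eqP; rewrite eq_complex /= addr0 add0r !eqxx.
apply: le_trans (normcD _ _) _; rewrite normcR lerD2l /=.
by rewrite expr0n add0r sqrtr_sqr.
Qed.

Lemma normc_rotate z :
  exists c, normc c = 1 /\ complex.Re (c * z) = normc z.
Proof.
have [->|z0] := eqVneq z 0.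
  by exists 1; rewrite mulr0 /= expr0n expr1n !addr0 sqrtr1 sqrtr0.
have nz0 : normc z != 0 by apply: contra z0 => /eqP/Normc.eq0_normc ->.
have nJ : normc z^* = normc z by apply: complexI; rewrite !Defs.normcE normcJ.
exists (z^* / (normc z)%:C); rewrite Normc.normcM Normc.normcV normcR nJ.
rewrite ger0_norm ?normc_ge0// divff//; split=> //.
rewrite mulrAC [_ * z]mulrC -sqr_normc -Defs.normcE -!rmorphXn -fmorphV -rmorphM /=.
by rewrite expr2 mulfK.
Qed.

Lemma cvg_normcP (T : Type) (F : set_system T) (f : T -> R[i]) (l : R[i]) :
  Filter F ->
  f @ F --> l <-> forall e : R, 0 < e -> \forall x \near F, normc (f x - l) <= e.
Proof.
move=> FF; split=> [/cvgrPdist_le fl e e0|fl].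
  have := fl e%:C; rewrite ltcR => /(_ e0); apply: filterS => x.
  by rewrite -Defs.normcE lecR normcB.
apply/cvgrPdist_le => e e0; have [k ek] := complex_realP _ (gtr0_real e0).
move: e0; rewrite ek ltcR => /fl; apply: filterS => x.
by rewrite -Defs.normcE lecR normcB.
Qed.

End modulus.

Section epsilon.
Context {R : realType} {a b : R}.
Implicit Types (x y : R -> R[i]) (t u : R).

Lemma within_continuousP x : {within `[a, b], continuous x} <->
  forall t, t \in `[a, b] -> forall e : R, 0 < e -> exists2 d : R, 0 < d &
    forall u, u \in `[a, b] -> `|u - t| < d -> normc (x u - x t) <= e.
Proof.
split=> [/subspace_continuousP xc t tab e e0|xc].
  have /cvg_normcP /(_ e e0) := xc t tab.
  move=> /nbhs_ballP[d /= d0 h]; exists d => // u uab ud.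
  by apply: h => //; rewrite /ball /= distrC.
apply/subspace_continuousP => t tab; apply/cvg_normcP => e e0.
have [d d0 h] := xc t tab e e0.
apply/nbhs_ballP; exists d => //= u ud uab; apply: h => //.
by move: ud; rewrite /ball /= distrC.
Qed.

(** Multiplying out the denominator admits [u = t], so that this criterion and
    its real counterpart below combine by the triangle inequality alone. *)
Lemma dquotP x t (l : R[i]) :
  dquot x t @ within `[a, b] t^' --> l <->
  forall e : R, 0 < e -> exists2 d : R, 0 < d & forall u, u \in `[a, b] ->
    `|u - t| < d -> normc (x u - x t - l * (u - t)%:C) <= e * `|u - t|.
Proof.
have E u : u != t -> forall e, (normc (dquot x t u - l) <= e) =
    (normc (x u - x t - l * (u - t)%:C) <= e * `|u - t|).
  move=> ut e; have ut0 : u - t != 0 by rewrite subr_eq0.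
  have -> : x u - x t - l * (u - t)%:C = (dquot x t u - l) * (u - t)%:C.
    rewrite mulrBl /dquot divfK//.
    by apply: contra ut0 => /eqP/complexI ->.
  by rewrite Normc.normcM normcR ler_pM2r// normr_gt0.
split=> [/cvg_normcP xl e e0|xl].
  have /nbhs_ballP[d /= d0 h] := xl e e0; exists d => // u uab ud.
  have [->|ut] := eqVneq u t.
    by rewrite !subrr mulr0 subrr normr0 mulr0 Normc.normc0.
  by rewrite -E//; apply: h => //=; rewrite /ball /= distrC.
apply/cvg_normcP => e e0; have [d d0 h] := xl e e0.
apply/nbhs_ballP; exists d => //= u ud ut uab; rewrite E //.
by apply: h => //; move: ud; rewrite /ball /= distrC.
Qed.

Lemma is_deriveP (f : R -> R) t (l : R) :
  is_derive t 1 f l <->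
  forall e : R, 0 < e -> exists2 d : R, 0 < d & forall u,
    `|u - t| < d -> `|f u - f t - l * (u - t)| <= e * `|u - t|.
Proof.
have E h : h != 0 -> forall e, (`|l - h^-1 *: (f (h *: 1 + t) - f t)| <= e) =
    (`|f (h + t) - f t - l * h| <= e * `|h|).
  move=> h0 e; rewrite -(ler_pM2r (x := `|h|)) ?normr_gt0// -normrM distrC.
  by rewrite mulrBl /GRing.scale /= mulr1 mulrAC mulVf// mul1r.
have D : is_derive t 1 f l <-> h^-1 *: (f (h *: 1 + t) - f t) @[h --> 0^'] --> l.
  split=> [[fd fl]|fl]; first by rewrite -fl; exact: fd.
  by split; [apply/cvg_ex; exists l|apply: cvg_lim].
split=> [/D/cvgrPdist_le fl e e0|fl].
  have /nbhs_ballP[d /= d0 h] := fl e e0; exists d => // u ud.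
  have [->|ut] := eqVneq u t; first by rewrite !subrr mulr0 subrr normr0 mulr0.
  have ut0 : u - t != 0 by rewrite subr_eq0.
  have := h (u - t); rewrite (E _ ut0) subrK => /(_ _ ut0); apply.
  by rewrite /ball /= sub0r normrN.
apply/D/cvgrPdist_le => e e0; have [d d0 h] := fl e e0.
apply/nbhs_ballP; exists d => //= u ud u0; rewrite E//.
have := h (u + t); rewrite addrK; apply.
by move: ud; rewrite /ball /= sub0r normrN.
Qed.

End epsilon.

(** * Mean value inequality and primitives *)

Section calculus.
Context {R : realType} {a b : R} (hab : a < b).
Implicit Types (x y : R -> R[i]) (t u : R).

#[local] Opaque deriv_itv derivable_itv sup_norm.

Lemma left_in_itv : a \in `[a, b].
Proof. by rewrite in_itv /= lexx ltW. Qed.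

Lemma ReB (z w : R[i]) : complex.Re (z - w) = complex.Re z - complex.Re w.
Proof. by case: z => ? ?; case: w. Qed.

Lemma cvg_Re (T : Type) (F : set_system T) (f : T -> R[i]) (c l : R[i]) :
  Filter F -> f @ F --> l ->
  complex.Re (c * f i) @[i --> F] --> complex.Re (c * l).
Proof.
move=> FF fl; have /cvg_normcP cfl : c * f i @[i --> F] --> c * l.
  by apply: cvgMr.
apply/cvgrPdist_le => e /cfl; apply: filterS => i; apply: le_trans.
by rewrite distrC -ReB Re_le_normc.
Qed.

(** The mean value inequality for complex functions reduces to the real
    monotonicity criterion, applied to [g - Re (c * x)] where [c] rotates
    [x t - x a] onto the positive real axis. *)
Lemma normc_sub_le_of_deriv x (g g' : R -> R) :
  {within `[a, b], continuous x} ->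
  (forall t, t \in `]a, b[ -> derivable_itv a b x t) ->
  (forall t, is_derive t 1 g (g' t)) ->
  (forall t, t \in `]a, b[ -> normc (deriv_itv a b x t) <= g' t) ->
  forall t, t \in `[a, b] -> normc (x t - x a) <= g t - g a.
Proof.
move=> xc xd gd xg t tab; have [c [nc1 cE]] := normc_rotate (x t - x a).
pose h u := g u - complex.Re (c * x u).
have hd u : u \in `]a, b[ ->
    is_derive u 1 h (g' u - complex.Re (c * deriv_itv a b x u)).
  move=> uab; have uab' := subset_itv_oo_cc uab; apply/is_deriveP => e e0.
  have e20 : 0 < e / 2 by rewrite divr_gt0.
  have [d1 d10 h1] := (is_deriveP g u (g' u)).1 (gd u) _ e20.
  have [d2 d20 h2] := (dquotP _ _ _).1 (derivable_itvP uab' (xd _ uab)) _ e20.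
  move: uab; rewrite in_itv /= => /andP[au ub].
  exists (Num.min (Num.min d1 d2) (Num.min (u - a) (b - u))).
    by rewrite !lt_min d10 d20 !subr_gt0 au ub.
  move=> v; rewrite !lt_min => /andP[/andP[v1 v2] /andP[v3 v4]].
  have vab : v \in `[a, b].
    move: v3 v4; rewrite !ltr_norml in_itv /= => /andP[? ?] /andP[? ?].
    by apply/andP; split; lra.
  have -> : h v - h u - (g' u - complex.Re (c * deriv_itv a b x u)) * (v - u) =
      (g v - g u - g' u * (v - u)) -
      complex.Re (c * (x v - x u - deriv_itv a b x u * (v - u)%:C)).
    rewrite /h; case: (c) (x v) (x u) (deriv_itv a b x u) => [? ?] [? ?] [? ?].
    by case=> ? ? /=; ring.
  apply: le_trans (ler_normB _ _) _; rewrite [e]splitr mulrDl.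
  apply: lerD; first exact: h1.
  by apply: le_trans (Re_le_normc _) _; rewrite Normc.normcM nc1 mul1r h2.
have hc : {within `[a, b], continuous h}.
  apply/subspace_continuousP => u uab; apply: cvgB.
    apply: cvg_within_filter; apply: differentiable_continuous.
    by apply/derivable1_diffP; have := gd u; case.
  by apply: cvg_Re; move/subspace_continuousP: xc; exact.
suff : h a <= h t.
  by rewrite /h -cE mulrBr ReB; lra.
have at_ : a <= t by move: tab; rewrite in_itv => /andP[].
apply: (@ger0_derive1_le_cc _ h a b) => //; last exact: left_in_itv.
  by move=> u /hd; case.
move=> u uab; have hu := hd u uab; rewrite derive1E derive_val subr_ge0.
apply: le_trans (xg _ uab); rewrite -[leRHS]mul1r -nc1 -Normc.normcM.
exact: le_trans (ler_norm _) (Re_le_normc _).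
Qed.

(** Continuity of [x], which membership in [C^(l.+1)] includes, is a consequence
    of the existence of the difference quotients' limits. *)
Lemma is_Cl_primitive l x x' : (forall t, t \notin `[a, b] -> x t = 0) ->
  is_Cl a b l x' ->
  (forall t, t \in `[a, b] -> dquot x t @ within `[a, b] t^' --> x' t) ->
  is_Cl a b l.+1 x /\ deriv_itv a b x = x'.
Proof.
move=> x0 Cx' xx'.
have E : deriv_itv a b x = x'.
  apply/funext => t; have [tab|tab] := boolP (t \in `[a, b]).
    exact (deriv_itvP hab tab (xx' t tab)).2.
  by have [x'0 _ _] := Cx'; rewrite deriv_itv_out// x'0.
split; last exact: E.
apply/is_ClS; rewrite E; split; [exact: x0| |
  by move=> t tab; exact (deriv_itvP hab tab (xx' t tab)).1|exact: Cx'].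
apply/within_continuousP => t tab e e0.
have [d d0 h] := (dquotP _ _ _).1 (xx' t tab) 1 ltr01.
pose K := 1 + normc (x' t).
have K0 : 0 < K by rewrite ltr_pwDl// normc_ge0.
exists (Num.min d (e / K)); first by rewrite lt_min d0 divr_gt0.
move=> u uab; rewrite lt_min => /andP[ud ue].
have {h} := h u uab ud; rewrite mul1r => h.
apply: le_trans (normc_le_sub _ (x' t * (u - t)%:C)) _.
apply: le_trans (lerD (lexx _) h) _; rewrite Normc.normcM normcR.
rewrite -[X in _ + X]mul1r -mulrDl addrC -/K mulrC -ler_pdivlMr//.
exact: ltW.
Qed.

Lemma real_primitive (f : R -> R) : {within `[a, b], continuous f} ->
  exists F : R -> R, forall t, t \in `[a, b] -> is_derive t 1 F (f t).
Proof.
move=> /subspace_continuousP fc.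
(* Freezing [f] outside [a, b] makes it continuous on the whole line, so that
   the end points need no special treatment. *)
pose p u := Num.max a (Num.min u b).
have pab u : p u \in `[a, b].
  rewrite in_itv /= /p le_max lexx /= ge_max (ltW hab) /=.
  by rewrite ge_min lexx orbT.
have p_lip u v : `|p u - p v| <= `|u - v|.
  have := ler_norm (u - v); have := ler_norm (v - u); rewrite distrC ler_norml.
  move: (ltW hab); rewrite /p /Num.max /Num.min.
  by repeat case: ifPn; rewrite -?leNgt => *; apply/andP; split; lra.
have gc : continuous (f \o p).
  move=> u; apply/cvgrPdist_le => e e0.
  have /cvgrPdist_le /(_ e e0) /nbhs_ballP[d /= d0 h] := fc _ (pab u).
  apply/nbhs_ballP; exists d => //= v uv; apply: h => //.
  exact: le_lt_trans (p_lip _ _) uv.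
pose F (y : R) := (\int[lebesgue_measure]_(t in [set` `[a - 1, y]]) (f \o p) t)%R.
exists F => t tab; have ft : (f \o p) t = f t.
  move: tab; rewrite in_itv /= => /andP[at_ tb].
  by rewrite /p /= (min_l tb) (max_r at_).
have [ta tb] : a - 1 < t /\ t < b + 1.
  by move: tab; rewrite in_itv /= => /andP[? ?]; split; lra.
have int : lebesgue_measure.-integrable `[a - 1, b + 1] (EFin \o (f \o p)).
  apply: continuous_compact_integrable; first exact: segment_compact.
  exact: continuous_subspaceT.
have [Fd FE] := continuous_FTC1_closed tb int ta (gc t).
by split=> //; rewrite -derive1E FE.
Qed.

(** The fundamental theorem of calculus is applied to the real and imaginary
    parts separately. *)
Lemma primitive_ex x : is_Cl a b 0 x ->
  exists X, [/\ is_Cl a b 1 X, deriv_itv a b X = x & X a = 0].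
Proof.
move=> Cx; have [_ xc] := (is_Cl0P _ _ _).1 Cx.
have [F1 F1d] : exists F1 : R -> R, forall t, t \in `[a, b] ->
    is_derive t 1 F1 (complex.Re (1 * x t)).
  apply: real_primitive; apply/subspace_continuousP => t tab.
  by apply: cvg_Re; move/subspace_continuousP: xc; exact.
have [F2 F2d] : exists F2 : R -> R, forall t, t \in `[a, b] ->
    is_derive t 1 F2 (complex.Re (- 'i * x t)).
  apply: real_primitive; apply/subspace_continuousP => t tab.
  by apply: cvg_Re; move/subspace_continuousP: xc; exact.
pose X t := if t \in `[a, b] then (F1 t - F1 a) +i* (F2 t - F2 a) else 0.
exists X; have Xout t : t \notin `[a, b] -> X t = 0 by rewrite /X => /negbTE ->.
have [] := is_Cl_primitive Xout Cx; last first.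
  by move=> CX XE; split=> //; rewrite /X left_in_itv !subrr.
move=> t tab; apply/dquotP => e e0; have e20 : 0 < e / 2 by rewrite divr_gt0.
have [d1 d10 h1] := (is_deriveP _ _ _).1 (F1d t tab) _ e20.
have [d2 d20 h2] := (is_deriveP _ _ _).1 (F2d t tab) _ e20.
exists (Num.min d1 d2); first by rewrite lt_min d10.
move=> u uab; rewrite lt_min => /andP[/h1 {}h1 /h2 {}h2].
rewrite [e]splitr mulrDl; apply: le_trans (lerD h1 h2).
apply: le_trans (normc_le_ReIm _ _); rewrite /X uab tab.
set z := (X in normc X <= _); set w := (X in _ <= normc X).
suff -> : z = w by [].
rewrite /z /w; case: (x t) => p q; apply/eqP; rewrite eq_complex /=.
by apply/andP; split; apply/eqP; ring.
Qed.

End calculus.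

(** * Norms and completeness of the spaces of C^l functions *)

Section norms.
Context {R : realType} {a b : R} (hab : a < b).
Implicit Types (x y : R -> R[i]) (t u : R) (l : nat).

#[local] Opaque deriv_itv derivable_itv sup_norm.

Lemma Cl_norm0 x : Cl_norm a b 0 x = sup_norm a b x.
Proof. by rewrite /Cl_norm big_ord_recl big_ord0 addr0. Qed.

Lemma Cl_normS l x :
  Cl_norm a b l.+1 x = sup_norm a b x + Cl_norm a b l (deriv_itv a b x).
Proof.
rewrite /Cl_norm big_ord_recl; congr (_ + _); apply: eq_bigr => k _.
by congr sup_norm; rewrite /derivn_itv /bump /= -iterSr.
Qed.

Lemma Cl_within_continuous l x : is_Cl a b l x ->
  {within `[a, b], continuous x}.
Proof. by case=> _ _ /(_ 0%N isT). Qed.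

Lemma Cl_normSr l x : is_Cl a b l.+1 x -> Cl_norm a b l x <= Cl_norm a b l.+1 x.
Proof.
move=> [_ _ xc]; rewrite /Cl_norm [leRHS]big_ord_recr /= lerDl.
exact (sup_norm_ge0 hab (xc _ (leqnn _))).
Qed.

Lemma sup_norm_le_Cl_norm l x : is_Cl a b l x ->
  sup_norm a b x <= Cl_norm a b l x.
Proof.
by move=> Cx; apply: (sup_norm_le hab) => t; exact: (normc_le_Cl_norm hab Cx).
Qed.

Lemma deriv_itv_Cl l x : is_Cl a b l.+1 x -> is_Cl a b l (deriv_itv a b x).
Proof. by move=> /is_ClS[]. Qed.

Lemma Cl_derivable l x t : is_Cl a b l.+1 x -> t \in `[a, b] ->
  derivable_itv a b x t.
Proof. by move=> /is_ClS[_ _ + _]; exact. Qed.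

Lemma subfE x y : x \- y = x \+ (-1 \*o y).
Proof. by apply/funext => t; rewrite /= mulN1r. Qed.

Lemma is_ClB l x y : is_Cl a b l x -> is_Cl a b l y -> is_Cl a b l (x \- y).
Proof.
by move=> Cx Cy; rewrite subfE; apply: (is_ClD hab Cx (is_ClZ hab _ Cy).1).1.
Qed.

Lemma deriv_itvBf l x y : is_Cl a b l.+1 x -> is_Cl a b l.+1 y ->
  deriv_itv a b (x \- y) = deriv_itv a b x \- deriv_itv a b y.
Proof.
move=> Cx Cy; rewrite subfE.
have := (is_ClD hab Cx (is_ClZ hab (-1) Cy).1).2 1%N isT.
have := (is_ClZ hab (-1) Cy).2 1%N isT.
by rewrite /derivn_itv /= => -> ->; rewrite -subfE.
Qed.

Lemma deriv_itvMf l x y : is_Cl a b l.+1 x -> is_Cl a b l.+1 y ->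
  deriv_itv a b (x \* y) =
  (deriv_itv a b x \* y) \+ (x \* deriv_itv a b y).
Proof.
move=> Cx Cy; apply/funext => t; have [tab|tab] := boolP (t \in `[a, b]).
  have xc := Cl_within_continuous Cx.
  exact: (deriv_itvM hab tab xc (Cl_derivable Cx tab) (Cl_derivable Cy tab)).2.
by rewrite /= !(deriv_itv_out _ tab) mul0r mulr0 addr0.
Qed.

(** By induction with the Leibniz rule: each derivative at most doubles the
    constant. *)
Lemma Cl_normM l x y : is_Cl a b l x -> is_Cl a b l y ->
  Cl_norm a b l (x \* y) <= 2 ^+ l * (Cl_norm a b l x * Cl_norm a b l y).
Proof.
have M0 (z w : R -> R[i]) : {within `[a, b], continuous z} ->
    {within `[a, b], continuous w} ->
    sup_norm a b (z \* w) <= sup_norm a b z * sup_norm a b w.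
  move=> zc wc; apply: (sup_norm_le hab) => t tab /=; rewrite Normc.normcM.
  by apply: ler_pM; rewrite ?normc_ge0//; exact: (normc_le_sup_norm hab).
elim: l x y => [|l IH] x y Cx Cy.
  rewrite !Cl_norm0 mul1r.
  by apply: M0; [exact: Cl_within_continuous Cx|exact: Cl_within_continuous Cy].
have [Cx1 Cy1] := (is_Cl_le (leqnSn l) Cx, is_Cl_le (leqnSn l) Cy).
have [Cx' Cy'] := (deriv_itv_Cl Cx, deriv_itv_Cl Cy).
rewrite Cl_normS (deriv_itvMf Cx Cy).
have h0 := M0 _ _ (Cl_within_continuous Cx) (Cl_within_continuous Cy).
have h1 := Cl_normD hab (is_ClM hab Cx' Cy1) (is_ClM hab Cx1 Cy').
have h2 := IH _ _ Cx' Cy1; have h3 := IH _ _ Cx1 Cy'.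
have := Cl_normSr Cx; have := Cl_normSr Cy; rewrite !Cl_normS.
move: h0 h1 h2 h3 (sup_norm_ge0 hab (Cl_within_continuous Cx))
  (sup_norm_ge0 hab (Cl_within_continuous Cy)).
have := Cl_norm_ge0 hab Cx'; have := Cl_norm_ge0 hab Cy'.
have := Cl_norm_ge0 hab Cx1; have := Cl_norm_ge0 hab Cy1.
move: (sup_norm a b x) (sup_norm a b y) => x0 y0.
move: (Cl_norm a b l x) (Cl_norm a b l y) => x1 y1.
move: (Cl_norm a b l (deriv_itv a b x)) (Cl_norm a b l (deriv_itv a b y)).
move=> x' y' y1p x1p y'p x'p h0 h1 h2 h3 x0p y0p hy hx.
apply: le_trans (lerD h0 (le_trans h1 (lerD h2 h3))) _.
have q1 : 1 <= 2 ^+ l :> R by rewrite exprn_ege1// ler1n.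
rewrite exprS; move: (2 ^+ l : R) q1 => q q1.
have k1 : x' * y1 <= x' * (y0 + y') by apply: ler_wpM2l.
have k2 : x1 * y' <= (x0 + x') * y' by apply: ler_wpM2r.
have k3 : x0 * y0 <= q * (x0 * y0) by apply: ler_peMl => //; exact: mulr_ge0.
have k4 : 0 <= q * (x0 * y0) by rewrite !mulr_ge0//; lra.
have k5 : 0 <= q * (x' * y0) by rewrite !mulr_ge0//; lra.
have k6 : 0 <= q * (x0 * y') by rewrite !mulr_ge0//; lra.
have q0 : 0 <= q by lra.
have := ler_wpM2l q0 k1; have := ler_wpM2l q0 k2; lra.
Qed.

Lemma Cl_norm_sum l I (r : seq I) (F : I -> R -> R[i]) :
  (forall i, is_Cl a b l (F i)) ->
  Cl_norm a b l (fun t => \sum_(i <- r) F i t) <= \sum_(i <- r) Cl_norm a b l (F i).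
Proof.
move=> CF; elim: r => [|i r IH].
  have C0 := is_Cl_0 hab l; rewrite big_nil.
  rewrite [X in Cl_norm _ _ _ X](_ : _ = 0 \*o (fun=> 0)).
    by rewrite (Cl_normZ hab 0 C0) Normc.normc0 mul0r.
  by apply/funext => t; rewrite big_nil /= mul0r.
rewrite big_cons [X in Cl_norm _ _ _ X](_ : _ =
    F i \+ (fun t => \sum_(i <- r) F i t)); last first.
  by apply/funext => t; rewrite big_cons.
apply: le_trans (Cl_normD hab (CF i) (is_Cl_sum hab _ CF)) _.
by rewrite lerD2l.
Qed.

Lemma sup_norm_le_deriv x : is_Cl a b 1 x ->
  sup_norm a b x <= normc (x a) + (b - a) * sup_norm a b (deriv_itv a b x).
Proof.
move=> Cx; have C'c := Cl_within_continuous (deriv_itv_Cl Cx).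
set M := sup_norm a b (deriv_itv a b x).
have M0 : 0 <= M := sup_norm_ge0 hab C'c.
apply: (sup_norm_le hab) => t tab.
apply: le_trans (normc_le_sub _ (x a)) _; rewrite lerD2l.
have gd u : is_derive u 1 (fun v : R => M * v) M.
  by apply: is_derive_eq; rewrite scaler1.
have := @normc_sub_le_of_deriv _ _ _ hab x (fun v => M * v) (fun=> M)
  (Cl_within_continuous Cx) _ gd _ t tab.
move=> h; apply: (le_trans (h _ _)).
- by move=> u /subset_itv_oo_cc; exact: Cl_derivable Cx.
- by move=> u /subset_itv_oo_cc; exact: (normc_le_sup_norm hab).
- rewrite -mulrBr mulrC; apply: ler_wpM2r => //.
  by move: tab; rewrite in_itv /= => /andP[_ ?]; rewrite lerD2r.
Qed.

Definition cst_itv (c : R[i]) : R -> R[i] := fun t =>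
  if t \in `[a, b] then c else 0.

Lemma cst_itvE c t : t \in `[a, b] -> cst_itv c t = c.
Proof. by rewrite /cst_itv => ->. Qed.

Lemma is_Cl_cst c l : is_Cl a b l (cst_itv c) /\
  deriv_itv a b (cst_itv c) = fun=> 0.
Proof.
have [] := @is_Cl_primitive _ _ _ hab l (cst_itv c) (fun=> 0).
- by move=> t /negbTE tab; rewrite /cst_itv tab.
- exact: is_Cl_0.
- move=> t tab; apply/dquotP => e e0; exists 1 => // u uab _.
  by rewrite !cst_itvE// subrr mul0r subrr Normc.normc0 mulr_ge0// ltW.
- by move=> C1 E; split; [exact: is_Cl_le (leqnSn l) C1|exact: E].
Qed.

End norms.

Section completeness.
Context {R : realType} {a b : R} (hab : a < b).
Implicit Types (x y : R -> R[i]) (t : R) (l : nat).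

#[local] Opaque deriv_itv derivable_itv sup_norm.

Lemma le_of_le_halves (r c D : R) : (forall n, r <= D / 2 ^+ n + c) -> r <= c.
Proof.
move=> h; have q0 n : 0 < 2 ^+ n :> R by rewrite exprn_gt0.
rewrite leNgt; apply/negP => cr; pose n := (Num.truncn (D / (r - c))).+1.
have rc : 0 < r - c by rewrite subr_gt0.
have := h n; rewrite -lerBlDr ler_pdivlMr//; apply/negP.
rewrite -ltNge -ltr_pdivrMl// mulrC.
have n1 : D / (r - c) < n%:R by rewrite truncnS_gt.
apply: lt_le_trans n1 _; rewrite -natrX ler_nat; exact/ltnW/ltn_expl.
Qed.

Lemma real_halving_limit (u : nat -> R) (D : R) :
  (forall n, `|u n.+1 - u n| <= D / 2 ^+ n) ->
  exists p : R, forall n, `|p - u n| <= 2 * D / 2 ^+ n.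
Proof.
move=> uD; have q0 n : 0 < 2 ^+ n :> R by rewrite exprn_gt0.
have D0 : 0 <= D by have := le_trans (normr_ge0 _) (uD 0%N); rewrite expr0 divr1.
pose v n := u n - 2 * D / 2 ^+ n; pose w n := u n + 2 * D / 2 ^+ n.
have E n : 2 * D / 2 ^+ n.+1 = D / 2 ^+ n.
  by rewrite exprS invfM mulrACA divff// mul1r.
have vS : {homo v : m n / (m <= n)%N >-> m <= n}.
  apply: (homo_leq (@lexx _ _) (@le_trans _ _)) => n; rewrite /v E.
  by have := uD n; rewrite ler_norml => /andP[? ?]; rewrite -mulrA; lra.
have wS : {homo w : m n / (m <= n)%N >-> n <= m}.
  apply: (homo_leq (@lexx _ _) (fun _ _ _ h1 h2 => le_trans h2 h1)) => n.
  rewrite /w E.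
  by have := uD n; rewrite ler_norml => /andP[? ?]; rewrite -mulrA; lra.
have vw m n : v m <= w n.
  apply: le_trans (vS _ _ (leq_maxl m n)) _.
  apply: le_trans (wS _ _ (leq_maxr m n)); rewrite /v /w.
  have d0 : 0 <= 2 * D / 2 ^+ maxn m n by rewrite !mulr_ge0// invr_ge0 ltW.
  by rewrite lerD2l; lra.
exists (sup (range v)) => n.
have lv : v n <= sup (range v).
  apply: ub_le_sup; last by exists n.
  by exists (w 0%N) => _ [m _ <-].
have lw : sup (range v) <= w n.
  by apply: ge_sup => [|_ [m _ <-]//]; exists (v 0%N), 0%N.
by rewrite ler_norml; move: lv lw; rewrite /v /w => ? ?; apply/andP; split; lra.
Qed.

Lemma complex_halving_limit (z : nat -> R[i]) (D : R) :
  (forall n, normc (z n.+1 - z n) <= D / 2 ^+ n) ->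
  exists w : R[i], forall n, normc (w - z n) <= 4 * D / 2 ^+ n.
Proof.
move=> zD.
have [p hp] : exists p, forall n, `|p - complex.Re (z n)| <= 2 * D / 2 ^+ n.
  apply: real_halving_limit => n; apply: le_trans (zD n).
  by apply: le_trans (Re_le_normc _); rewrite ReB.
have [q hq] : exists q, forall n, `|q - complex.Im (z n)| <= 2 * D / 2 ^+ n.
  apply: real_halving_limit => n; apply: le_trans (zD n).
  apply: le_trans (Im_le_normc _).
  by case: (z n.+1) (z n) => ? ? [].
exists (p +i* q) => n.
have -> : 4 * D / 2 ^+ n = 2 * D / 2 ^+ n + 2 * D / 2 ^+ n by ring.
apply: le_trans (lerD (hp n) (hq n)); case: (z n) => r s.
exact: normc_le_ReIm.
Qed.

(** Pointwise limits exist by completeness of the real line, applied to real and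
    imaginary parts; the uniform rate makes the limit continuous. *)
Lemma C0_complete (x : nat -> R -> R[i]) (D : R) :
  (forall n, is_Cl a b 0 (x n)) ->
  (forall n, sup_norm a b (x n.+1 \- x n) <= D / 2 ^+ n) ->
  exists y, is_Cl a b 0 y /\
    forall n, sup_norm a b (y \- x n) <= 4 * D / 2 ^+ n.
Proof.
move=> Cx xD.
have /choice[f fP] t : exists w : R[i], t \in `[a, b] ->
    forall n, normc (w - x n t) <= 4 * D / 2 ^+ n.
  have [tab|] := boolP (t \in `[a, b]); last by exists 0.
  have [|l lP] := @complex_halving_limit (x^~ t) D; last by exists l.
  move=> n; apply: le_trans (xD n).
  apply: (normc_le_sup_norm hab _ tab).
  exact: Cl_within_continuous (is_ClB hab (Cx _) (Cx _)).
pose y t := if t \in `[a, b] then f t else 0.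
have yx t n : t \in `[a, b] -> normc (y t - x n t) <= 4 * D / 2 ^+ n.
  by move=> tab; rewrite /y tab; exact: fP.
have yc : {within `[a, b], continuous y}.
  apply/within_continuousP => t tab e e0.
  have [n nD] : exists n, 4 * D / 2 ^+ n <= e / 3.
    apply: contrapT => /forallNP hn.
    suff : e / 3 <= 0 by lra.
    apply: (@le_of_le_halves _ _ (4 * D)) => n; rewrite addr0.
    by apply: ltW; rewrite ltNge; apply/negP/hn.
  have /within_continuousP/(_ t tab) := Cl_within_continuous (Cx n).
  have e30 : 0 < e / 3 by lra.
  move=> /(_ _ e30)[d d0 h]; exists d => // u uab ud.
  have h1 := yx u n uab; have h2 := yx t n tab; have h3 := h u uab ud.
  have -> : y u - y t = (y u - x n u) + ((x n u - x n t) - (y t - x n t)).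
    by ring.
  apply: le_trans (normcD _ _) _.
  have := normcD (x n u - x n t) (- (y t - x n t)); rewrite normcN; lra.
exists y; split; last by move=> n; apply: (sup_norm_le hab) => t tab; exact: yx.
by apply/is_Cl0P; split=> // t /negbTE tab; rewrite /y tab.
Qed.

(** The derivatives converge by induction on [l]; the limit of the functions is
    the primitive of that of the derivatives with the right value at [a], by the
    mean value inequality. *)
Lemma Cl_complete l (x : nat -> R -> R[i]) (D : R) :
  (forall n, is_Cl a b l (x n)) ->
  (forall n, Cl_norm a b l (x n.+1 \- x n) <= D / 2 ^+ n) ->
  exists y, is_Cl a b l y /\
    exists C, forall n, Cl_norm a b l (y \- x n) <= C / 2 ^+ n.
Proof.
elim: l x => [|l IH] x Cx xD.
  have [|y [Cy yx]] := C0_complete Cx (D := D).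
    by move=> n; rewrite -Cl_norm0.
  exists y; split=> //; exists (4 * D) => n; rewrite Cl_norm0; exact: yx.
have CB n := is_ClB hab (Cx n.+1) (Cx n).
have [||z [Cz [C1 zx]]] := IH (fun n => deriv_itv a b (x n)).
- by move=> n; exact: deriv_itv_Cl (Cx n).
- move=> n; rewrite -(deriv_itvBf hab (Cx _) (Cx _)).
  apply: le_trans (xD n); rewrite Cl_normS lerDr.
  exact: (sup_norm_ge0 hab) (Cl_within_continuous (CB n)).
have [n|n|w [Cw wx]] := @C0_complete x D.
- exact: is_Cl_le (Cx n).
- exact: le_trans (sup_norm_le_Cl_norm hab (CB n)) (xD n).
have Cz0 : is_Cl a b 0 z by exact: is_Cl_le Cz.
have [Z [CZ ZE Za]] := primitive_ex hab Cz0.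
have CZl : is_Cl a b l.+1 Z.
  move: CZ => /is_ClS[Z0 Zc Zd _]; apply/is_ClS; rewrite ZE.
  by split; [exact: Z0|exact: Zc|exact: Zd|exact: Cz].
have [Cc cE] := is_Cl_cst hab (w a) l.+1.
pose y := Z \+ cst_itv (a := a) (b := b) (w a).
have Cy : is_Cl a b l.+1 y := (is_ClD hab CZl Cc).1.
have yE : deriv_itv a b y = z.
  have := (is_ClD hab CZl Cc).2 1%N isT; rewrite /derivn_itv /= => ->.
  by rewrite cE ZE; apply/funext => t /=; rewrite addr0.
exists y; split; first exact: Cy.
exists ((4 * D + (b - a) * C1) + C1) => n; rewrite Cl_normS mulrDl.
have CB' := is_ClB hab Cy (Cx n).
rewrite (deriv_itvBf hab Cy (Cx n)) yE; apply: lerD; last exact: zx.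
apply: le_trans (sup_norm_le_deriv hab (is_Cl_le _ CB')) _ => //.
rewrite (deriv_itvBf hab Cy (Cx n)) yE [leRHS]mulrDl; apply: lerD.
  have aab := left_in_itv hab.
  rewrite /y /= Za add0r cst_itvE//; apply: le_trans (wx n).
  apply: (normc_le_sup_norm hab (x := w \- x n) _ aab).
  exact: Cl_within_continuous (is_ClB hab Cw (is_Cl_le _ (Cx n))).
rewrite -mulrA; apply: ler_wpM2l; first by rewrite subr_ge0 ltW.
apply: le_trans (zx n); apply: (sup_norm_le_Cl_norm hab).
exact (is_ClB hab Cz (deriv_itv_Cl (Cx n))).
Qed.

End completeness.

(** * A priori estimates for linear systems *)

Section linear_system.
Context {R : realType} {a b : R} (hab : a < b) {m : nat}.
Implicit Types (x : R -> R[i]) (t : R) (l : nat).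
Implicit Types (al : 'I_m -> 'I_m -> R -> R[i]) (y z : 'I_m -> R -> R[i]).

#[local] Opaque deriv_itv derivable_itv sup_norm.

(** The factor 2 in the exponent is what makes [weight_halving] gain 1/2. *)
Definition weight (c K t : R) : R := expR (2 * K * (t - c)).

Lemma weight_ge1 K t : 0 < K -> t \in `[a, b] -> 1 <= weight a K t.
Proof.
move=> K0; rewrite in_itv /= => /andP[at_ _].
by rewrite /weight -expR0 ler_expR !mulr_ge0// ?subr_ge0// ltW.
Qed.

Lemma weight_le K t : 0 < K -> t \in `[a, b] -> weight a K t <= weight a K b.
Proof.
move=> K0; rewrite in_itv /= => /andP[_ tb].
by rewrite /weight ler_expR ler_wpM2l ?lerD2r// mulr_ge0// ltW.
Qed.

(** One integration halves a bound expressed in terms of the weight: this is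
    why the Picard iteration converges on the whole of [a, b] at once, and
    what replaces Gronwall's inequality. *)
Lemma weight_halving x (K W G : R) : 0 < K -> 0 <= W -> 0 <= G ->
  is_Cl a b 1 x -> x a = 0 ->
  (forall t, t \in `[a, b] ->
    normc (deriv_itv a b x t) <= K * (W * weight a K t) + G) ->
  forall t, t \in `[a, b] -> normc (x t) <= (W / 2 + G * (b - a)) * weight a K t.
Proof.
move=> K0 W0 G0 Cx xa xd t tab.
pose g u := W / 2 * weight a K u + G * u.
have gd (u : R) : is_derive u 1 g (K * (W * weight a K u) + G).
  rewrite /g /weight; apply: is_derive_eq.
  rewrite /GRing.scale /= !mulr1 subr0; by field.
have := normc_sub_le_of_deriv hab (Cl_within_continuous Cx) _ gd _ tab.
rewrite xa subr0 => h; apply: le_trans (h _ _) _.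
- by move=> u /subset_itv_oo_cc; exact: Cl_derivable Cx.
- by move=> u /subset_itv_oo_cc; exact: xd.
have E1 := weight_ge1 K0 tab.
have E0 : weight a K a = 1 by rewrite /weight subrr mulr0 expR0.
have k1 : G * (t - a) <= G * (b - a) * weight a K t.
  have tb : t - a <= b - a.
    by move: tab; rewrite in_itv /= => /andP[_ tb]; rewrite lerD2r.
  apply: le_trans (ler_wpM2l G0 tb) _; apply: ler_peMr => //.
  by rewrite mulr_ge0// subr_ge0 ltW.
rewrite /g E0; lra.
Qed.

Definition coupling al y (i : 'I_m) : R -> R[i] :=
  fun t => \sum_(j < m) al i j t * y j t.

Lemma is_Cl_coupling l al y i : (forall i j, is_Cl a b l (al i j)) ->
  (forall j, is_Cl a b l (y j)) -> is_Cl a b l (coupling al y i).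
Proof.
move=> Cal Cy; apply: (is_Cl_sum hab) => j.
exact (is_ClM hab (Cal i j) (Cy j)).
Qed.

Lemma normc_coupling al y i t (M W : R) :
  (forall j, normc (al i j t) <= M) -> (forall j, normc (y j t) <= W) ->
  normc (coupling al y i t) <= (m%:R * M) * W.
Proof.
move=> alM yW; apply: le_trans (normc_sum _ _) _.
rewrite -mulrA -[m in m%:R]card_ord mulr_natl -sumr_const.
apply: ler_sum => j _.
by rewrite Normc.normcM ler_pM ?normc_ge0.
Qed.

Lemma Cl_norm_coupling l al y i (M W : R) : 0 <= M ->
  (forall i j, is_Cl a b l (al i j)) -> (forall j, is_Cl a b l (y j)) ->
  (forall i j, Cl_norm a b l (al i j) <= M) ->
  (forall j, Cl_norm a b l (y j) <= W) ->
  Cl_norm a b l (coupling al y i) <= m%:R * (2 ^+ l * (M * W)).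
Proof.
move=> M0 Cal Cy alM yW.
apply: le_trans (Cl_norm_sum hab _ (fun j => is_ClM hab (Cal i j) (Cy j))) _.
rewrite -[m in m%:R]card_ord mulr_natl -sumr_const; apply: ler_sum => j _.
apply: le_trans (Cl_normM hab (Cal i j) (Cy j)) _.
apply: ler_wpM2l; first by rewrite exprn_ge0.
by apply: ler_pM => //; [exact: (Cl_norm_ge0 hab (Cal i j))|
  exact: (Cl_norm_ge0 hab (Cy j))].
Qed.

(** Start from any bound of [y] relative to the weight: each integration of the
    equation halves it, up to a fixed multiple of [G]. *)
Lemma sup_norm_a_priori (M : R) : 0 <= M -> exists C : R, 0 <= C /\
  forall al y (G : R), (forall i j, is_Cl a b 0 (al i j)) ->
    (forall i j, sup_norm a b (al i j) <= M) ->
    (forall i, is_Cl a b 1 (y i)) -> (forall i, y i a = 0) ->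
    (forall i t, t \in `[a, b] ->
      normc (deriv_itv a b (y i) t + coupling al y i t) <= G) ->
    0 <= G -> forall i, sup_norm a b (y i) <= C * G.
Proof.
move=> M0; pose K := 1 + m%:R * M.
have K0 : 0 < K by rewrite ltr_pwDl// mulr_ge0.
have ba : 0 <= b - a by rewrite subr_ge0 ltW.
exists (2 * (b - a) * weight a K b); split; first by rewrite !mulr_ge0// expR_ge0.
move=> al y G Cal alM Cy ya yG G0.
pose W0 := \sum_(i < m) sup_norm a b (y i).
have yc i : {within `[a, b], continuous (y i)} := Cl_within_continuous (Cy i).
have W00 : 0 <= W0 by apply: sumr_ge0 => i _; exact: (sup_norm_ge0 hab (yc i)).
have c0 : 0 <= 2 * (G * (b - a)) by rewrite !mulr_ge0.
have key n i t : t \in `[a, b] ->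
    normc (y i t) <= (W0 / 2 ^+ n + 2 * (G * (b - a))) * weight a K t.
  elim: n i t => [|n IH] i t tab.
    apply: (@le_trans _ _ W0).
      apply: le_trans (normc_le_sup_norm hab (yc i) tab) _.
      rewrite /W0 (bigD1 i)//= lerDl; apply: sumr_ge0 => j _.
      exact: (sup_norm_ge0 hab (yc j)).
    rewrite expr0 divr1; apply: (@le_trans _ _ (W0 + 2 * (G * (b - a)))).
      by rewrite lerDl.
    by apply: ler_peMr; [exact: addr_ge0|exact: weight_ge1].
  pose W := W0 / 2 ^+ n + 2 * (G * (b - a)).
  have W_ge0 : 0 <= W by rewrite addr_ge0// divr_ge0// exprn_ge0.
  have -> : W0 / 2 ^+ n.+1 + 2 * (G * (b - a)) = W / 2 + G * (b - a).
    have : 2 ^+ n != 0 :> R by rewrite expf_neq0.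
    by rewrite /W exprS => ?; field.
  apply: (weight_halving K0 W_ge0 G0 (Cy i) (ya i) _ tab) => u uab.
  have -> : deriv_itv a b (y i) u =
      - coupling al y i u + (deriv_itv a b (y i) u + coupling al y i u).
    by rewrite addrCA addNr addr0.
  apply: le_trans (normcD _ _) _; apply: lerD; last exact: yG.
  rewrite normcN.
  apply: le_trans (@normc_coupling al y i u M (W * weight a K u) _ _) _.
  - move=> j; apply: le_trans (alM i j).
    exact: (normc_le_sup_norm hab (Cl_within_continuous (Cal i j)) uab).
  - by move=> j; exact: IH.
  - apply: ler_wpM2r; first by rewrite mulr_ge0// expR_ge0.
    by rewrite /K lerDr.
move=> i; apply: (sup_norm_le hab) => t tab.
have bab : b \in `[a, b] by rewrite in_itv /= lexx ltW.
apply: (@le_of_le_halves _ _ _ (W0 * weight a K b)) => n.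
apply: le_trans (key n i t tab) _.
have -> : W0 * weight a K b / 2 ^+ n + 2 * (b - a) * weight a K b * G =
    (W0 / 2 ^+ n + 2 * (G * (b - a))) * weight a K b by ring.
apply: ler_wpM2l; last exact: weight_le.
by rewrite addr_ge0// divr_ge0// exprn_ge0.
Qed.

(** Induction on the order: the next derivative of [y] is read off the equation,
    whose coefficients multiply lower derivatives only. *)
Lemma Cl_norm_a_priori n (M : R) : 0 <= M -> exists C : R, 0 <= C /\
  forall al y (G : R), (forall i j, is_Cl a b n (al i j)) ->
    (forall i j, Cl_norm a b n (al i j) <= M) ->
    (forall i, is_Cl a b n.+1 (y i)) -> (forall i, y i a = 0) ->
    (forall i, Cl_norm a b n (deriv_itv a b (y i) \+ coupling al y i) <= G) ->
    forall i, Cl_norm a b n.+1 (y i) <= C * G.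
Proof.
move=> M0; have [C0 [C0_ge0 hC0]] := sup_norm_a_priori M0.
have mono k x : is_Cl a b n x -> (k <= n)%N ->
    Cl_norm a b k x <= Cl_norm a b n x.
  elim: n => [|p IH] in x * => Cx; first by rewrite leqn0 => /eqP ->.
  rewrite leq_eqVlt => /predU1P[->//|kp].
  apply: le_trans (Cl_normSr hab Cx); apply: IH => //.
  exact: is_Cl_le Cx.
suff H l : (l <= n.+1)%N -> exists C : R, 0 <= C /\
    forall al y (G : R), (forall i j, is_Cl a b n (al i j)) ->
    (forall i j, Cl_norm a b n (al i j) <= M) ->
    (forall i, is_Cl a b n.+1 (y i)) -> (forall i, y i a = 0) ->
    (forall i, Cl_norm a b n (deriv_itv a b (y i) \+ coupling al y i) <= G) ->
    forall i, Cl_norm a b l (y i) <= C * G.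
  exact: H.
have Cres al y i : (forall i j, is_Cl a b n (al i j)) ->
    (forall i, is_Cl a b n.+1 (y i)) ->
    is_Cl a b n (deriv_itv a b (y i) \+ coupling al y i).
  move=> Cal Cy; apply: (is_ClD hab (deriv_itv_Cl (Cy i)) _).1.
  by apply: is_Cl_coupling => // j; exact: is_Cl_le (Cy j).
have base al y (G : R) : (forall i j, is_Cl a b n (al i j)) ->
    (forall i j, Cl_norm a b n (al i j) <= M) ->
    (forall i, is_Cl a b n.+1 (y i)) -> (forall i, y i a = 0) ->
    (forall i, Cl_norm a b n (deriv_itv a b (y i) \+ coupling al y i) <= G) ->
    forall i, sup_norm a b (y i) <= C0 * G.
  move=> Cal alM Cy ya yG i; apply: (hC0 al y G) => //.
  - by move=> j k; exact: is_Cl_le (Cal j k).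
  - by move=> j k; exact: le_trans (sup_norm_le_Cl_norm hab (Cal j k)) (alM j k).
  - by move=> j; exact: is_Cl_le (Cy j).
  - move=> j t tab; apply: le_trans (yG j).
    exact: (normc_le_Cl_norm hab (Cres al y j Cal Cy) tab).
  - by apply: le_trans (yG i); exact: (Cl_norm_ge0 hab (Cres al y i Cal Cy)).
elim: l => [|l IH] ln.
  exists C0; split=> // al y G Cal alM Cy ya yG i; rewrite Cl_norm0.
  exact: (base al y G).
have [C [C_ge0 hC]] := IH (ltnW ln).
exists (C0 + (1 + m%:R * (2 ^+ l * (M * C)))); split.
  by rewrite !addr_ge0// !mulr_ge0// exprn_ge0.
move=> al y G Cal alM Cy ya yG i.
rewrite Cl_normS [leRHS]mulrDl; apply: lerD; first exact: (base al y G).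
have -> : deriv_itv a b (y i) =
    (deriv_itv a b (y i) \+ coupling al y i) \- coupling al y i.
  by apply/funext => t /=; rewrite addrK.
have lln : (l <= n)%N by [].
have Cal' j k : is_Cl a b l (al j k) by exact: is_Cl_le (Cal j k).
have Cy' j : is_Cl a b l (y j) by exact: is_Cl_le (leqW lln) (Cy j).
have Cc := is_Cl_coupling i Cal' Cy'.
have Cr := is_Cl_le lln (Cres al y i Cal Cy).
rewrite subfE; apply: le_trans (Cl_normD hab Cr (is_ClZ hab (-1) Cc).1) _.
rewrite (Cl_normZ hab _ Cc) normcN Normc.normc1 mul1r [leRHS]mulrDl mul1r.
apply: lerD.
  exact: le_trans (mono _ _ (Cres al y i Cal Cy) lln) (yG i).
apply: le_trans (@Cl_norm_coupling l al y i M (C * G) M0 Cal' Cy' _ _) _.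
- by move=> j k; apply: le_trans (alM j k); exact: mono.
- by move=> j; exact: (hC al y G).
- by rewrite !mulrA.
Qed.

End linear_system.

(** * Existence of solutions of linear systems *)

Section existence.
Context {R : realType} {a b : R} (hab : a < b) {m : nat}.
Implicit Types (x : R -> R[i]) (t : R).
Implicit Types (al : 'I_m -> 'I_m -> R -> R[i]) (y z w : 'I_m -> R -> R[i]).

#[local] Opaque deriv_itv derivable_itv sup_norm.

(** Picard iteration: by [weight_halving] the successive differences decay like
    [2 ^- n], so that [C0_complete] provides the limit, and the regularity of
    the limit is read off the equation. *)
Lemma linear_system_solution n al (v : 'I_m -> R[i]) :
  (forall i j, is_Cl a b n (al i j)) ->
  exists y, [/\ forall i, is_Cl a b n.+1 (y i),
    forall i, deriv_itv a b (y i) = (fun t => - coupling al y i t) &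
    forall i, y i a = v i].
Proof.
move=> Cal; have aab := left_in_itv hab.
have ba : 0 <= b - a by rewrite subr_ge0 ltW.
have Cal0 i j : is_Cl a b 0 (al i j) by exact: is_Cl_le (Cal i j).
pose M := \sum_(i < m) \sum_(j < m) sup_norm a b (al i j).
have al0 i j : 0 <= sup_norm a b (al i j).
  exact: (sup_norm_ge0 hab (Cl_within_continuous (Cal i j))).
have alM i j t : t \in `[a, b] -> normc (al i j t) <= M.
  move=> tab; apply: le_trans
    (normc_le_sup_norm hab (Cl_within_continuous (Cal i j)) tab) _.
  rewrite /M (bigD1 i)//= (bigD1 j)//= -addrA lerDl addr_ge0//.
    by apply: sumr_ge0.
  by apply: sumr_ge0 => k _; apply: sumr_ge0.
have M0 : 0 <= M by apply: sumr_ge0 => i _; apply: sumr_ge0.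
pose K := 1 + m%:R * M.
have K0 : 0 < K by rewrite ltr_pwDl// mulr_ge0.
have [P PP] : exists P, forall x, is_Cl a b 0 x ->
    [/\ is_Cl a b 1 (P x), deriv_itv a b (P x) = x & P x a = 0].
  have /choice[P PP] x : exists X, is_Cl a b 0 x ->
      [/\ is_Cl a b 1 X, deriv_itv a b X = x & X a = 0].
    have [Cx|nCx] := pselect (is_Cl a b 0 x); last by exists x.
    by have [X XP] := primitive_ex hab Cx; exists X.
  by exists P.
pose T z i := P (-1 \*o coupling al z i) \+ cst_itv (a := a) (b := b) (v i).
have TP z i : (forall j, is_Cl a b 0 (z j)) ->
    [/\ is_Cl a b 1 (T z i),
        deriv_itv a b (T z i) = (fun t => - coupling al z i t) &
        T z i a = v i].
  move=> Cz; have Cc := (is_ClZ hab (-1) (is_Cl_coupling hab i Cal0 Cz)).1.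
  have [CP PE Pa] := PP _ Cc; have [Cv vE] := is_Cl_cst hab (v i) 1.
  split; first exact: (is_ClD hab CP Cv).1.
    have := (is_ClD hab CP Cv).2 1%N isT; rewrite /derivn_itv /= => ->.
    by rewrite PE vE; apply/funext => t /=; rewrite addr0 mulN1r.
  by rewrite /T /= Pa add0r cst_itvE.
have TB z w i t (W : R) : (forall j, is_Cl a b 0 (z j)) ->
    (forall j, is_Cl a b 0 (w j)) -> t \in `[a, b] ->
    (forall j, normc (z j t - w j t) <= W) ->
    normc (deriv_itv a b (T z i \- T w i) t) <= K * W.
  move=> Cz Cw tab zw.
  have [CTz zE _] := TP z i Cz; have [CTw wE _] := TP w i Cw.
  rewrite (deriv_itvBf hab CTz CTw) zE wE /= opprK addrC -normcB.
  have -> : coupling al z i t - coupling al w i t =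
      coupling al (fun j => z j \- w j) i t.
    by rewrite /coupling -sumrB; apply: eq_bigr => j _; rewrite -mulrBr.
  apply: le_trans (@normc_coupling _ _ al _ i t M W _ zw) _.
    by move=> j; exact: alM.
  have W0 : 0 <= W by apply: le_trans (zw i); exact: normc_ge0.
  by apply: ler_wpM2r => //; rewrite lerDr.
pose S k := iter k T (fun i => cst_itv (a := a) (b := b) (v i)).
have CS k i : is_Cl a b 1 (S k i).
  elim: k i => [|k IH] i; first exact: (is_Cl_cst hab _ _).1.
  have [j|C1 _ _] := TP (S k) i; first exact: is_Cl_le (IH j).
  exact: C1.
have CS0 k i : is_Cl a b 0 (S k i) by exact: is_Cl_le (CS k i).
have Sa k i : S k i a = v i.
  case: k => [|k]; first exact: cst_itvE.
  by have [] := TP (S k) i (CS0 k).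
have CSB i : is_Cl a b 1 (S 1%N i \- S 0%N i) := is_ClB hab (CS _ _) (CS _ _).
pose D := \sum_(i < m) sup_norm a b (S 1%N i \- S 0%N i).
have D_ge0 : 0 <= D.
  apply: sumr_ge0 => i _.
  exact: (sup_norm_ge0 hab (Cl_within_continuous (CSB i))).
have step k i t : t \in `[a, b] ->
    normc (S k.+1 i t - S k i t) <= D / 2 ^+ k * weight a K t.
  elim: k i t => [|k IH] i t tab.
    rewrite expr0 divr1; apply: (@le_trans _ _ D); last first.
      by apply: ler_peMr => //; exact: (weight_ge1 K0 tab).
    apply: (@le_trans _ _ (sup_norm a b (S 1%N i \- S 0%N i))).
      exact: (normc_le_sup_norm hab (Cl_within_continuous (CSB i)) tab).
    rewrite /D (bigD1 i)//= lerDl; apply: sumr_ge0 => j _.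
    exact: (sup_norm_ge0 hab (Cl_within_continuous (CSB j))).
  have W0 : 0 <= D / 2 ^+ k by rewrite divr_ge0// exprn_ge0.
  have -> : D / 2 ^+ k.+1 = D / 2 ^+ k / 2 + 0 * (b - a).
    by rewrite mul0r addr0 exprSr invfM mulrA.
  apply: (weight_halving (x := S k.+2 i \- S k.+1 i) hab K0 W0 (lexx 0) _ _ _ tab).
  - exact (is_ClB hab (CS k.+2 i) (CS k.+1 i)).
  - by change (S k.+2 i a - S k.+1 i a = 0); rewrite !Sa subrr.
  - move=> u uab; rewrite addr0; apply: (TB (S k.+1) (S k) i u) => // j.
    exact: IH.
have /choice[s sP] i : exists x, is_Cl a b 0 x /\ forall k,
    sup_norm a b (x \- S k i) <= 4 * (D * weight a K b) / 2 ^+ k.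
  apply: (C0_complete hab (CS0^~ i)) => k.
  apply: (sup_norm_le hab) => t tab; apply: le_trans (step k i t tab) _.
  rewrite [leRHS]mulrAC; apply: ler_wpM2l; last exact: weight_le.
  by rewrite divr_ge0// exprn_ge0.
have Cs i : is_Cl a b 0 (s i) := (sP i).1.
pose C := 4 * (D * weight a K b).
have sS i k t : t \in `[a, b] -> normc (s i t - S k i t) <= C / 2 ^+ k.
  move=> tab; apply: le_trans ((sP i).2 k).
  apply: (normc_le_sup_norm hab (x := s i \- S k i) _ tab).
  exact: Cl_within_continuous (is_ClB hab (Cs i) (CS0 k i)).
have sE : T s = s.
  apply/funext => i; apply/funext => t; have [CTs _ Tsa] := TP s i Cs.
  have [tab|tab] := boolP (t \in `[a, b]); last first.
    by have [s0 _ _] := Cs i; have [T0 _ _] := CTs; rewrite s0// T0.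
  apply/eqP; rewrite -subr_eq0; apply/eqP/Normc.eq0_normc/eqP.
  rewrite eq_le normc_ge0 andbT.
  apply: (@le_of_le_halves _ _ _ ((b - a) * (K * C) + C)) => k.
  rewrite addr0 mulrDl; have CB := is_ClB hab CTs (CS k.+1 i).
  have -> : T s i t - s i t = (T s i t - S k.+1 i t) - (s i t - S k.+1 i t).
    by ring.
  apply: le_trans (normcD _ _) _; rewrite normcN; apply: lerD; last first.
    apply: le_trans (sS i k.+1 t tab) _; apply: ler_wpM2l.
      by rewrite !mulr_ge0// expR_ge0.
    by rewrite lef_pV2 ?posrE ?exprn_gt0// ler_eXn2l// ltr1n.
  apply: le_trans (normc_le_sup_norm hab (x := T s i \- S k.+1 i)
    (Cl_within_continuous CB) tab) _.
  apply: le_trans (sup_norm_le_deriv hab CB) _.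
  have -> : (T s i \- S k.+1 i) a = 0.
    by change (T s i a - S k.+1 i a = 0); rewrite Tsa Sa subrr.
  rewrite Normc.normc0 add0r -2!mulrA.
  apply: ler_wpM2l => //; apply: (sup_norm_le hab) => u uab.
  exact (TB s (S k) i u _ Cs (CS0 k) uab (fun j => sS j k u uab)).
have dE i : deriv_itv a b (s i) = (fun t => - coupling al s i t).
  by have [_ + _] := TP s i Cs; rewrite sE.
exists s; split; last 2 first.
- exact: dE.
- by move=> i; have [_ _] := TP s i Cs; rewrite sE.
suff H k : (k <= n.+1)%N -> forall i, is_Cl a b k (s i) by exact: H.
elim: k => [|k IH] kn i; first exact: Cs.
have [+ _ _] := TP s i Cs; rewrite sE => /is_ClS[s0 sc sd _].
apply/is_ClS; split; [exact: s0|exact: sc|exact: sd|rewrite dE].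
have -> : (fun t => - coupling al s i t) = -1 \*o coupling al s i.
  by apply/funext => t; rewrite /= mulN1r.
apply: (is_ClZ hab _ _).1; apply: (is_Cl_coupling hab).
  by move=> j l; exact: is_Cl_le (Cal j l).
exact: IH (ltnW kn).
Qed.

End existence.

(** * Uniform boundedness principle *)

Section uniform_boundedness.
Context {R : realType} {V : lmodType R[i]} (N : V -> R).
Context (N_ge0 : forall v, 0 <= N v).
Context (ND : forall u v, N (u + v) <= N u + N v).
Context (NZ : forall c v, N (c *: v) = normc c * N v).
Context (N_complete : forall (x : nat -> V) (D : R),
  (forall n, N (x n.+1 - x n) <= D / 2 ^+ n) ->
  exists y (C : R), forall n, N (y - x n) <= C / 2 ^+ n).

Lemma seminormN (q : V -> R) : (forall c v, q (c *: v) = normc c * q v) ->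
  forall v, q (- v) = q v.
Proof. by move=> qZ v; rewrite -scaleN1r qZ normcN Normc.normc1 mul1r. Qed.

(** If uniform boundedness failed, there would be a nested sequence of balls,
    with some seminorm at least [n] on the whole of the n-th one; their common
    point, which completeness provides, contradicts pointwise boundedness. *)
Theorem uniform_boundedness (p : nat -> V -> R) :
  (forall k u v, p k (u + v) <= p k u + p k v) ->
  (forall k c v, p k (c *: v) = normc c * p k v) ->
  (forall k, exists c : R, forall v, p k v <= c * N v) ->
  (forall v, exists M : R, forall k, p k v <= M) ->
  exists M : R, forall k v, p k v <= M * N v.
Proof.
move=> pD pZ pc pb; apply: contrapT => unb.
have {}unb M : exists k v, M * N v < p k v.
  apply: contrapT => h; apply: unb; exists M => k v.
  by rewrite leNgt; apply/negP => Mp; apply: h; exists k, v.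
have NN := seminormN NZ; have pN k := seminormN (pZ k).
pose ok n (X X' : V * R) := 0 < X.2 ->
  [/\ 0 < X'.2, X'.2 <= X.2 / 2, N (X'.1 - X.1) <= X.2 / 2 &
   exists k, forall y, N (y - X'.1) <= X'.2 -> n%:R <= p k y].
have /choice[f fP] (nX : nat * (V * R)) : exists X', ok nX.1 nX.2 X'.
  case: nX => n [x r] /=; have [r0|r0] := ltP 0 r; last first.
    by exists (x, r) ; rewrite /ok /= ltNge r0.
  have [k [v kv]] := unb (2 * n.+1%:R / r); have [c pkc] := pc k.
  have Nv : 0 < N v.
    rewrite lt_neqAle N_ge0 andbT; apply/negP => /eqP Nv0.
    by have := lt_le_trans kv (pkc v); rewrite -Nv0 !mulr0 ltxx.
  pose u := (r / (2 * N v))%:C *: v.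
  have s0 : 0 <= r / (2 * N v) by rewrite divr_ge0// ?mulr_ge0// ltW.
  have Nu : N u = r / 2.
    by rewrite /u NZ normcR ger0_norm//; field; rewrite gt_eqF.
  have pu : n.+1%:R <= p k u.
    rewrite /u pZ normcR ger0_norm// mulrAC ler_pdivlMr ?mulr_gt0//.
    move/ltW: kv; rewrite mulrAC ler_pdivrMr//; lra.
  (* As [2 u = (x + u) - (x - u)], the seminorm is as large at one of [x + u],
     [x - u] as it is at [u]. *)
  have [x' [Nx' px']] : exists x', N (x' - x) = r / 2 /\ n.+1%:R <= p k x'.
    have [h|h] := leP n.+1%:R (p k (x + u)).
      by exists (x + u); rewrite addrAC subrr add0r.
    exists (x - u); rewrite addrAC subrr add0r NN Nu; split=> //.
    have : p k (u + u) <= p k (x + u) + p k (x - u).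
      have -> : u + u = (x + u) + (u - x) by rewrite [RHS]addrC addrA subrK.
      by rewrite -[p k (x - u)]pN opprB.
    rewrite -mulr2n -scaler_nat pZ.
    have -> : normc (2 : R[i]) = 2.
      have -> : (2 : R[i]) = (2 : R)%:C by rewrite rmorph_nat.
      by rewrite normcR ger0_norm.
    lra.
  pose c' := 1 + `|c|.
  have c'0 : 0 < c' by rewrite ltr_pwDl.
  (* The radius is so small that the continuous seminorm [p k] varies by at
     most 1 on the new ball. *)
  exists (x', Num.min (r / 2) c'^-1); split=> /=.
  - by rewrite lt_min invr_gt0 c'0 divr_gt0.
  - by rewrite ge_min lexx.
  - by rewrite Nx'.
  exists k => y; rewrite le_min => /andP[_ yx'].
  have h1 : p k x' <= p k y + p k (y - x').
    rewrite -[p k (y - x')]pN opprB.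
    by apply: le_trans (pD _ _ _); rewrite addrC subrK.
  have h2 : p k (y - x') <= 1.
    apply: le_trans (pkc _) _; apply: (@le_trans _ _ (c' * N (y - x'))).
      by apply: ler_wpM2r => //; rewrite /c'; have := ler_norm c; lra.
    by rewrite -ler_pdivlMl// mulr1.
  by move: px'; rewrite -natr1; lra.
pose X := fix X n := if n is n'.+1 then f (n', X n') else (0, 1) : V * R.
have X0 n : 0 < (X n).2.
  by elim: n => [|n IH] //=; have [] := fP (n, X n) IH.
have XS n : [/\ (X n.+1).2 <= (X n).2 / 2,
    N ((X n.+1).1 - (X n).1) <= (X n).2 / 2 &
    exists k, forall y, N (y - (X n.+1).1) <= (X n.+1).2 -> n%:R <= p k y].
  by have [] := fP (n, X n) (X0 n).
have Xr n : (X n).2 <= 1 / 2 ^+ n.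
  elim: n => [|n IH]; first by rewrite expr0 divr1.
  have [h _ _] := XS n; apply: le_trans h _.
  by rewrite exprSr invfM mulrA ler_pM2r ?invr_gt0.
have [n|y [C yX]] := N_complete (x := fun n => (X n).1) (D := 1).
  have [_ h _] := XS n; apply: le_trans h (le_trans _ (Xr n)).
  by have := X0 n; lra.
have nest n j : N ((X (n + j)%N).1 - (X n).1) <= (X n).2 - (X (n + j)%N).2.
  elim: j => [|j IH].
    by rewrite addn0 !subrr -(scale0r (0 : V)) NZ Normc.normc0 mul0r.
  rewrite addnS; have [h1 h2 _] := XS (n + j)%N.
  have -> : (X (n + j).+1%N).1 - (X n).1 =
     ((X (n + j).+1%N).1 - (X (n + j)%N).1) + ((X (n + j)%N).1 - (X n).1).
    by rewrite addrA subrK.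
  by apply: le_trans (ND _ _) _; lra.
have yXn n : N (y - (X n).1) <= (X n).2.
  apply: (@le_of_le_halves _ _ _ (C / 2 ^+ n)) => j.
  have -> : y - (X n).1 = (y - (X (n + j)%N).1) + ((X (n + j)%N).1 - (X n).1).
    by rewrite addrA subrK.
  apply: le_trans (ND _ _) _; apply: lerD.
    by rewrite -mulrA -invfM -exprD; exact: yX.
  by apply: le_trans (nest n j) _; have := X0 (n + j)%N; lra.
have [M pM] := pb y; pose n := (Num.truncn M).+1.
have [_ _ [k hk]] := XS n; have := hk y (yXn n.+1); apply/negP.
by rewrite -ltNge; apply: le_lt_trans (pM k) _; exact: truncnS_gt.
Qed.

End uniform_boundedness.

(** * Function spaces and the Cauchy problem *)

Section function_spaces.
Context {R : realType} {a b : R} {hab : a < b}.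
Implicit Types (x : R -> R[i]) (t : R).

#[local] Opaque deriv_itv derivable_itv sup_norm.

Lemma CspaceBE m n l (f g : Cspace hab m n l) i j :
  (fun t => (f - g) t i j) = (fun t => f t i j) \- (fun t => g t i j).
Proof. by apply/funext => t; rewrite !mxE. Qed.

Lemma Cspace_norm_ge0 m n l (f : Cspace hab m n l) : 0 <= Cspace_norm f.
Proof. exact: bigmax_ge_id. Qed.

Lemma Cspace_norm_le m n l (f : Cspace hab m n l) (W : R) : 0 <= W ->
  (forall i j, Cl_norm a b l (fun t => f t i j) <= W) ->
  Cspace_norm f <= m%:R * W.
Proof.
move=> W0 fW; apply/bigmax_leP; split=> [|j _]; first exact: mulr_ge0.
rewrite -[m in m%:R]card_ord mulr_natl -sumr_const.
by apply: ler_sum => i _; exact: fW.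
Qed.

Lemma Cspace_complete m n l (f : nat -> Cspace hab m n l) (D : R) :
  (forall k, Cspace_norm (f k.+1 - f k) <= D / 2 ^+ k) ->
  exists (g : Cspace hab m n l) (C : R),
    forall k, Cspace_norm (g - f k) <= C / 2 ^+ k.
Proof.
move=> fD.
have /choice[y yP] (ij : 'I_m * 'I_n) : exists xC : (R -> R[i]) * R,
    is_Cl a b l xC.1 /\ forall k,
    Cl_norm a b l (xC.1 \- (fun t => f k t ij.1 ij.2)) <= xC.2 / 2 ^+ k.
  have [k|k|x [Cx [C xC]]] := Cl_complete hab (l := l) (D := D)
      (x := fun k t => f k t ij.1 ij.2).
  - exact: (CspaceP (f k)).
  - by rewrite -CspaceBE; exact: le_trans (le_Cspace_norm _ _ _) (fD k).
  - by exists (x, C).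
have gP : (fun t => \matrix_(i, j) (y (i, j)).1 t) \in Cmx_pred a b m n l.
  apply/asboolP => i j.
  rewrite [X in is_Cl _ _ _ X](_ : _ = (y (i, j)).1); first exact: (yP (i, j)).1.
  by apply/funext => t; rewrite mxE.
exists (MkCspace hab gP), (m%:R * \sum_ij `|(y ij).2|) => k; rewrite -mulrA.
apply: Cspace_norm_le => [|i j].
  by rewrite divr_ge0 ?exprn_ge0 ?sumr_ge0.
rewrite CspaceBE [X in X \- _](_ : _ = (y (i, j)).1); last first.
  by apply/funext => t; rewrite mxE.
apply: le_trans ((yP (i, j)).2 k) _; apply: ler_wpM2r.
  by rewrite invr_ge0 exprn_ge0.
by apply: le_trans (ler_norm _) _; rewrite (bigD1 (i, j))//= lerDl sumr_ge0.
Qed.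

(** The Cauchy problem imposes its equation on the open interval only, while
    the norms see the end points. *)
Lemma Cl0_eq0 x : is_Cl a b 0 x -> (forall t, t \in `]a, b[ -> x t = 0) ->
  x = fun=> 0.
Proof.
move=> Cx x0; apply/funext => t; have [tab|] := boolP (t \in `[a, b]); last first.
  by case: Cx => + _ _; exact.
apply/Normc.eq0_normc/eqP; rewrite eq_le normc_ge0 andbT.
apply/ler_addgt0Pr => e e0; rewrite add0r.
have [d d0 h] := (within_continuousP x).1 (Cl_within_continuous Cx) t tab e e0.
pose s := Num.min (2^-1) (d / (b - a)).
have ba : 0 < b - a by rewrite subr_gt0.
have [s0 s1 sd] : [/\ 0 < s, s <= 2^-1 & s * (b - a) <= d].
  split; first by rewrite lt_min divr_gt0 ?invr_gt0 ?ltr0n.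
    by rewrite ge_min lexx.
  by rewrite -ler_pdivlMr// ge_min lexx orbT.
(* Move from [t] towards the midpoint of [a, b]. *)
pose u := t + s * ((a + b) / 2 - t).
move: (tab); rewrite in_itv /= => /andP[at_ tb].
have sa : 0 <= s * (t - a) <= 2^-1 * (t - a).
  by rewrite mulr_ge0 ?ler_wpM2r ?subr_ge0//; lra.
have sb : 0 <= s * (b - t) <= 2^-1 * (b - t).
  by rewrite mulr_ge0 ?ler_wpM2r ?subr_ge0//; lra.
have sba : 0 < s * (b - a) by rewrite mulr_gt0.
move: sa sb => /andP[sa1 sa2] /andP[sb1 sb2].
have uab : u \in `]a, b[.
  by rewrite in_itv /= /u; apply/andP; split; lra.
have := h u (subset_itv_oo_cc uab); rewrite x0// sub0r normcN; apply.
by rewrite ltr_norml /u; apply/andP; split; lra.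
Qed.

End function_spaces.

Section cauchy_problem.
Context {R : realType} {a b : R} {hab : a < b} {m n : nat}.
Implicit Types (A : Cspace hab m m n) (y : Cspace hab m 1 n.+1).

#[local] Opaque deriv_itv derivable_itv sup_norm.

Definition entries A (i j : 'I_m) : R -> R[i] := fun t => A t i j.

Definition components y (i : 'I_m) : R -> R[i] := fun t => y t i 0.

Lemma LopE (hs : (0 < n.+1)%N) A y i :
  (fun t => Lop (s := n.+1) hs A y t i 0) =
  deriv_itv a b (components y i) \+ coupling (entries A) (components y) i.
Proof. by apply/funext => t; rewrite !mxE. Qed.

(** Since a solution exists, the chosen one is not the default value. *)
Lemma cauchy_solP A : cauchy_problem (s := n.+1) A (cauchy_sol (s := n.+1) A).
Proof.
rewrite /cauchy_sol; suff [Y YP] : exists Y, cauchy_problem (s := n.+1) A Y.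
  by apply: xgetPex; exists Y.
have CA i j : is_Cl a b n (entries A i j) := CspaceP A i j.
have /choice[y yP] (j : 'I_m) := linear_system_solution hab
  (fun i => (i == j)%:R) CA.
have YP : (fun t => \matrix_(i, j) y j i t) \in Cmx_pred a b m m n.+1.
  apply/asboolP => i j; have [Cy _ _] := yP j.
  rewrite [X in is_Cl _ _ _ X](_ : _ = y j i); first exact: Cy.
  by apply/funext => t; rewrite mxE.
exists (MkCspace hab YP); split=> [t tab|]; apply/matrixP => i j.
  have [_ yE _] := yP j; rewrite !mxE /=.
  rewrite [X in deriv_itv _ _ X](_ : _ = y j i); last first.
    by apply/funext => u; rewrite mxE.
  rewrite yE /coupling addrC; apply/eqP; rewrite subr_eq0; apply/eqP.
  by apply: eq_bigr => k _; rewrite mxE.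
by have [_ _ ya] := yP j; rewrite !mxE ya.
Qed.

Lemma Lop_cauchy_sol (hs : (0 < n.+1)%N) A j :
  Lop (s := n.+1) hs A (Ccol (cauchy_sol (s := n.+1) A) j) = 0.
Proof.
have [YA _] := cauchy_solP A; apply/val_inj/funext => t; apply/matrixP => i k.
rewrite (ord1 k) [RHS]mxE.
set y := Ccol _ _.
have := @Cl0_eq0 _ _ _ hab (fun t => Lop (s := n.+1) hs A y t i 0).
move=> h; apply: (congr1 (fun f => f t) (h _ _)) => {h t}.
  exact: is_Cl_le (CspaceP (Lop (s := n.+1) hs A y) i 0).
move=> t /YA/matrixP/(_ i j); rewrite !mxE /= => YA0.
rewrite -[RHS]YA0; congr (_ + _).
  by congr (deriv_itv a b _ t); apply/funext => u; rewrite mxE.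
by apply: eq_bigr => l _; rewrite mxE.
Qed.

(** The derivative of a constant vanishes, so that [L] maps the constant unit
    vectors to the columns of [A]: bounds on [L] yield bounds on [A]. *)
Lemma Lop_unit_vector (j : 'I_m) : exists y : Cspace hab m 1 n.+1,
  forall (hs : (0 < n.+1)%N) A i,
    (fun t => Lop (s := n.+1) hs A y t i 0) = entries A i j.
Proof.
pose c i := cst_itv (a := a) (b := b) ((i == j)%:R : R[i]).
have Cc i := is_Cl_cst hab ((i == j)%:R : R[i]) n.+1.
have yP : (fun t => \matrix_(i < m, k < 1) c i t) \in Cmx_pred a b m 1 n.+1.
  apply/asboolP => i k.
  rewrite [X in is_Cl _ _ _ X](_ : _ = c i); first exact: (Cc i).1.
  by apply/funext => t; rewrite mxE.
exists (MkCspace hab yP) => hs A i; rewrite LopE.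
have -> : components (MkCspace hab yP) = c.
  by apply/funext => k; apply/funext => t; rewrite /components mxE.
rewrite (Cc i).2; apply/funext => t /=; rewrite add0r /coupling.
have [tab|tab] := boolP (t \in `[a, b]); last first.
  have [A0 _ _] := CspaceP A i j; rewrite /entries A0//.
  by apply: big1 => k _; rewrite /c /cst_itv (negbTE tab) mulr0.
rewrite (bigD1 j)//= /c !cst_itvE// eqxx mulr1 big1 ?addr0// => k /negbTE kj.
by rewrite cst_itvE// kj mulr0.
Qed.

End cauchy_problem.

(** * Convergence of the characteristic matrices *)

Section convergence.
Context {R : realType}.

Lemma cvg_mx_entries m n (T : Type) (F : set_system T) (f : T -> 'M[R[i]]_(m, n))
    (M : 'M[R[i]]_(m, n)) : Filter F ->
  (forall i j, f x i j @[x --> F] --> M i j) -> f @ F --> M.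
Proof.
move=> FF fM A [P MP PA]; rewrite /nbhs /=.
suff : \forall x \near F, forall i j, P i j (f x i j).
  by apply: filterS => x; exact: PA.
apply: filter_forall => i; apply: filter_forall => j.
exact: fM (MP i j).
Qed.

Lemma near_bounded (u : nat -> R) (M : R) :
  (\forall k \near \oo, u k <= M) -> exists M' : R, forall k, u k <= M'.
Proof.
move=> [K _ uM]; exists (Num.max M (\sum_(k < K) `|u k|)) => k.
have [Kk|kK] := leqP K k; first by rewrite le_max uM.
rewrite le_max (bigD1 (Ordinal kK))//= orbC.
by rewrite (le_trans (ler_norm _))// lerDl sumr_ge0.
Qed.

Context {a b : R} {hab : a < b} {m l : nat}.

Lemma cvg_Cspace_norm (F : set_system nat) (f : nat -> Cspace hab m 1 l) g :
  Filter F -> f @ F --> g ->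
  forall e : R, 0 < e -> \forall k \near F, Cspace_norm (f k - g) <= e.
Proof.
move=> FF /cvgrPdist_le fg e e0; have := fg e%:C; rewrite ltcR => /(_ e0).
by apply: filterS => k; rewrite distrC /Num.norm /= lecR.
Qed.

Lemma continuous_entry_bound r (B : {linear Cspace hab m 1 l -> 'cV[R[i]]_r}) i :
  continuous B -> exists c : R, forall v, normc (B v i 0) <= c * Cspace_norm v.
Proof.
move=> Bc.
have /linear_boundedP/pinfty_ex_gt0[M M0 BM] : bounded_near B (nbhs 0).
  by apply: continuous_linear_bounded; exact: Bc.
have [c cM] := complex_realP _ (gtr0_real M0); exists c => v.
have := BM v; rewrite cM => h; rewrite -lecR Defs.normcE rmorphM /=.
apply: le_trans h; rewrite /Num.norm /= mx_normE.
exact: (le_bigmax _ (fun ij : 'I_r * 'I_1 => `|B v ij.1 ij.2|%:nng) (i, 0)).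
Qed.

End convergence.

Section main.
Context {R : realType} {a b : R} {hab : a < b} {m r n : nat}.
Context (hs : (0 < n.+1)%N).
Context (A : Cspace hab m m n) (A_ : nat -> Cspace hab m m n).
Context (B : {linear Cspace hab m 1 n.+1 -> 'cV[R[i]]_r}).
Context (B_ : nat -> {linear Cspace hab m 1 n.+1 -> 'cV[R[i]]_r}).

#[local] Opaque deriv_itv derivable_itv sup_norm.

(** The difference [z] of the two columns satisfies [L_k z = - (L_k y - L y)] and
    [z a = 0], where [y] is the limit column, and the [A_k] are bounded because
    the values of [L_k] at constant unit vectors converge. *)
Lemma cauchy_sol_cvg :
  (forall y, Lop (s := n.+1) hs (A_ k) y @[k --> \oo] -->
    Lop (s := n.+1) hs A y) ->
  forall j (e : R), 0 < e -> \forall k \near \oo,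
    Cspace_norm (Ccol (cauchy_sol (s := n.+1) (A_ k)) j -
                 Ccol (cauchy_sol (s := n.+1) A) j) <= e.
Proof.
move=> HL j e e0.
have [M [M0 AM]] : exists M : R, 0 <= M /\
    forall k i i', Cl_norm a b n (entries (A_ k) i i') <= M.
  have /choice[M MP] (i' : 'I_m) : exists M : R, forall k i,
      Cl_norm a b n (entries (A_ k) i i') <= M.
    have [y yP] := @Lop_unit_vector _ _ _ hab m n i'.
    have h : \forall k \near \oo, Cspace_norm (Lop (s := n.+1) hs (A_ k) y)
        <= 1 + Cspace_norm (Lop (s := n.+1) hs A y).
      apply: filterS (cvg_Cspace_norm eventually_filter (HL y) ltr01) => k h.
      apply: le_trans (lerD h (lexx _)).
      by have := Cspace_normD (Lop (s := n.+1) hs (A_ k) y -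
        Lop (s := n.+1) hs A y) (Lop (s := n.+1) hs A y); rewrite subrK.
    have [M hM] := near_bounded h; exists M => k i; rewrite -(yP hs).
    exact: le_trans (le_Cspace_norm _ _ _) (hM k).
  exists (\sum_i' `|M i'|); split; first exact: sumr_ge0.
  move=> k i i'; apply: le_trans (MP i' k i) _; apply: le_trans (ler_norm _) _.
  by rewrite (bigD1 i')//= lerDl sumr_ge0.
have [C [C0 hC]] := Cl_norm_a_priori hab (m := m) n M0.
pose y := Ccol (cauchy_sol (s := n.+1) A) j.
have K0 : 0 < 1 + m%:R * C by rewrite ltr_pwDl// mulr_ge0.
have e'0 : 0 < e / (1 + m%:R * C) by rewrite divr_gt0.
apply: filterS (cvg_Cspace_norm eventually_filter (HL y) e'0) => k.
rewrite [X in _ - X](Lop_cauchy_sol hs A j) subr0 => hk.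
pose yk := Ccol (cauchy_sol (s := n.+1) (A_ k)) j.
set G := e / _ in hk.
have Cy (v : Cspace hab m 1 n.+1) i : is_Cl a b n.+1 (components v i).
  exact: CspaceP v i 0.
have CA i i' : is_Cl a b n (entries (A_ k) i i') := CspaceP (A_ k) i i'.
have zE i : components (yk - y) i = components yk i \- components y i.
  exact: CspaceBE.
have G0 : 0 <= G := ltW e'0.
have zG i : Cl_norm a b n.+1 (components (yk - y) i) <= C * G.
  apply: (hC (entries (A_ k)) (components (yk - y)) G CA (AM k)) => {}i.
  - exact: Cy.
  - have [_ Ya] := cauchy_solP (A_ k); have [_ Y'a] := cauchy_solP A.
    by rewrite zE /components /= !mxE Ya Y'a subrr.
  - have -> : deriv_itv a b (components (yk - y) i) \+
        coupling (entries (A_ k)) (components (yk - y)) i =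
        -1 \*o (fun t => Lop (s := n.+1) hs (A_ k) y t i 0).
      have := LopE hs (A_ k) yk i; rewrite [Lop _ _ _](Lop_cauchy_sol hs (A_ k) j).
      rewrite LopE zE (deriv_itvBf hab (Cy _ _) (Cy _ _)) => yk0.
      apply/funext => t; move/(congr1 (fun f => f t)): yk0; rewrite /= mxE.
      have -> : coupling (entries (A_ k)) (components (yk - y)) i t =
          coupling (entries (A_ k)) (components yk) i t -
          coupling (entries (A_ k)) (components y) i t.
        by rewrite /coupling -sumrB; apply: eq_bigr => i' _; rewrite zE -mulrBr.
      have E (p q p' q' : R[i]) :
          0 = p + q -> p - p' + (q - q') = -1 * (p' + q').
        by move=> pq; rewrite mulN1r -[RHS]add0r pq; ring.
      exact (E _ _ _ _).
    have CL := CspaceP (Lop (s := n.+1) hs (A_ k) y) i 0.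
    rewrite (Cl_normZ hab _ CL) normcN Normc.normc1 mul1r.
    exact: le_trans (le_Cspace_norm _ _ _) hk.
apply: (@le_trans _ _ (m%:R * (C * G))).
  apply: Cspace_norm_le => [|i i']; first exact: mulr_ge0.
  by rewrite (ord1 i'); exact: zG.
rewrite mulrA; apply: (@le_trans _ _ ((1 + m%:R * C) * G)).
  by apply: ler_wpM2r => //; rewrite lerDr.
by rewrite /G mulrC divfK// gt_eqF.
Qed.

(** Column by column, [B_k Y_k - B Y = B_k (Y_k - Y) + (B_k - B) Y]: uniform
    boundedness controls the first term, strong convergence the second. *)
Lemma char_mx_cvg : (forall k, continuous (B_ k)) ->
  (forall y, LBop (s := n.+1) hs (A_ k) (B_ k) y @[k --> \oo] -->
    LBop (s := n.+1) hs A B y) ->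
  char_mx (s := n.+1) (A_ k) (B_ k) @[k --> \oo] -->
  char_mx (s := n.+1) A B.
Proof.
move=> contB_ H.
have HL y : Lop (s := n.+1) hs (A_ k) y @[k --> \oo] --> Lop (s := n.+1) hs A y.
  exact: cvg_comp (H y) cvg_fst.
have HB y i : forall e : R, 0 < e ->
    \forall k \near \oo, normc (B_ k y i 0 - B y i 0) <= e.
  apply/cvg_normcP.
  exact: cvg_comp (cvg_comp _ _ (H y) cvg_snd) (@coord_continuous _ _ _ i 0 _).
apply: cvg_mx_entries => i j; apply/cvg_normcP => e e0.
have [M hM] : exists M : R, forall k v, normc (B_ k v i 0) <= M * Cspace_norm v.
  apply: (@uniform_boundedness R _ (@Cspace_norm _ _ _ hab m 1 n.+1)
    _ _ _ _ (fun k v => normc (B_ k v i 0))).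
  - exact: Cspace_norm_ge0.
  - exact: Cspace_normD.
  - exact: Cspace_normZ.
  - exact: Cspace_complete.
  - by move=> k u v; rewrite linearD mxE normcD.
  - by move=> k c v; rewrite linearZ mxE Normc.normcM.
  - by move=> k; exact (continuous_entry_bound i (contB_ k)).
  move=> v; apply: (near_bounded (M := 1 + normc (B v i 0))).
  apply: filterS (HB v i 1 ltr01) => k hk.
  by apply: le_trans (normc_le_sub _ (B v i 0)) _; rewrite addrC lerD2r.
pose y := Ccol (cauchy_sol (s := n.+1) A) j.
have M0 : 0 < 1 + `|M| by rewrite ltr_pwDl.
have e20 : 0 < e / 2 by rewrite divr_gt0.
have e'0 : 0 < e / 2 / (1 + `|M|) by rewrite divr_gt0.
have h1 := cauchy_sol_cvg HL j e'0; have h2 := HB y i _ e20.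
apply: filterS2 h1 h2 => k; rewrite -/y !mxE.
set yk := Ccol _ j => h1 h2.
have -> : B_ k yk i 0 - B y i 0 =
    B_ k (yk - y) i 0 + (B_ k y i 0 - B y i 0).
  by rewrite linearB !mxE addrA subrK.
apply: le_trans (normcD _ _) _; rewrite [e]splitr; apply: lerD => //.
apply: le_trans (hM _ _) _.
apply: (@le_trans _ _ ((1 + `|M|) * Cspace_norm (yk - y))).
  by apply: ler_wpM2r; [exact: Cspace_norm_ge0|have := ler_norm M; lra].
by rewrite mulrC -ler_pdivlMr.
Qed.

End main.

Theorem mainTheorem3 (R : realType) (a b : R) (hab : a < b) (m r s : nat)
    (hm : (1 <= m)%N) (hr : (1 <= r)%N) (hs : (1 <= s)%N)
    (A : Cspace hab m m s.-1) (A_ : nat -> Cspace hab m m s.-1)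
    (B : {linear Cspace hab m 1 s -> 'cV[R[i]]_r})
    (B_ : nat -> {linear Cspace hab m 1 s -> 'cV[R[i]]_r})
    (contB : continuous B) (contB_ : forall k : nat, continuous (B_ k)) :
  (forall y : Cspace hab m 1 s,
     LBop hs (A_ k) (B_ k) y @[k --> \oo] --> LBop hs A B y) ->
  char_mx (A_ k) (B_ k) @[k --> \oo] --> char_mx A B.
Proof.
case: s hs A A_ B B_ contB contB_ => [//|n] hs A A_ B B_ _ contB_.
exact: char_mx_cvg.
Qed.
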